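(* Let $n,m$ be positive integers and let $q(z,w)=\sum_{j=0}^{n}\sum_{k=0}^{m}a_{j,k}z^jw^k$ be a polynomial in two complex variables (with $a_{j,k}\in\mathbb{C}$). Define its reflection $\overleftarrow{q}(z,w)=z^nw^m\overline{q(1/\bar z,1/\bar w)}=\sum_{j=0}^{n}\sum_{k=0}^{m}\bar a_{n-j,m-k}z^jw^k$. Then $q$ has no zeros in the closed bidisk $\overline{\mathbb{D}}^2$ if and only if there exists $c>0$ such that $$|q(z,w)|^2-|\overleftarrow{q}(z,w)|^2\ \geq\ c\,(1-|z|^2)(1-|w|^2)\qquad\text{for all } z,w\in\overline{\mathbb{D}},$$ in which case we can take $c$ given by $$\frac1c=\frac{1}{(2\pi i)^2}\int_{\mathbb{T}^2}\frac{1}{|q(z,w)|^2}\,\frac{dz}{z}\frac{dw}{w}.$$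
   Context: $\mathbb{D}$ is the open unit disk in $\mathbb{C}$, $\overline{\mathbb{D}}$ its closure, $\mathbb{T}=\partial\mathbb{D}$, $\mathbb{T}^2=\mathbb{T}\times\mathbb{T}$. The measure $\frac{1}{(2\pi i)^2}\frac{dz}{z}\frac{dw}{w}$ is normalized Lebesgue measure on $\mathbb{T}^2$. The reflection is always taken at the fixed level $(n,m)$; the coefficients $a_{j,k}$ are arbitrary, so ''degree $(n,m)$'' means degree at most $n$ in $z$ and at most $m$ in $w$. *)

(* Defs.v *)
From HB Require Import structures.
From mathcomp Require Import all_boot all_order all_algebra.
From mathcomp Require Import complex ring.
From mathcomp Require Import all_classical all_reals all_analysis.

Set Implicit Arguments.
Unset Strict Implicit.
Unset Printing Implicit Defensive.

Import Order.TTheory GRing.Theory Num.Theory.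
Export ComplexField.Normc.

Local Open Scope classical_set_scope.
Local Open Scope complex_scope.
Local Open Scope ring_scope.

(* A two-variable polynomial of degree at most (n, m) is given by its matrix of
   coefficients. *)
Definition bipoly_eval (R : realType) (n m : nat) (a : 'M[R[i]]_(n.+1, m.+1))
    (z w : R[i]) : R[i] :=
  \sum_(j < n.+1) \sum_(k < m.+1) a j k * z ^+ j * w ^+ k.

(* [rev_ord j] has value [n - j]. *)
Definition reflection (R : realType) (n m : nat) (a : 'M[R[i]]_(n.+1, m.+1)) :
    'M[R[i]]_(n.+1, m.+1) :=
  \matrix_(j, k) (a (rev_ord j) (rev_ord k))^*.

Lemma reflectionE (R : realType) (n m : nat) (a : 'M[R[i]]_(n.+1, m.+1))
    (z w : R[i]) : z != 0 -> w != 0 ->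
  bipoly_eval (reflection a) z w =
  z ^+ n * w ^+ m * (bipoly_eval a (z^*)^-1 (w^*)^-1)^*.
Proof.
move=> z0 w0; rewrite /bipoly_eval (reindex_inj rev_ord_inj) rmorph_sum mulr_sumr.
apply: eq_bigr => j _.
rewrite (reindex_inj rev_ord_inj) rmorph_sum mulr_sumr; apply: eq_bigr => k _.
rewrite mxE !rev_ordK !rmorphM !rmorphXn !fmorphV /= !conjCK !subSS.
have XnB (x : R[i]) p (l : 'I_p.+1) : x != 0 -> x ^+ (p - l) = x ^+ p * x^-1 ^+ l.
  by move=> x0; rewrite exprVn expfB_cond // (negPf x0) add0n -ltnS.
by rewrite !XnB // mulrA mulrACA mulrA; ring.
Qed.

Definition zero_free_closed_bidisk (R : realType) (n m : nat)
    (a : 'M[R[i]]_(n.+1, m.+1)) : Prop :=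
  forall z w : R[i], normc z <= 1 -> normc w <= 1 -> bipoly_eval a z w != 0.

Definition bidisk_bound (R : realType) (n m : nat)
    (a : 'M[R[i]]_(n.+1, m.+1)) (c : R) : Prop :=
  forall z w : R[i], normc z <= 1 -> normc w <= 1 ->
    c * (1 - normc z ^+ 2) * (1 - normc w ^+ 2) <=
    normc (bipoly_eval a z w) ^+ 2 - normc (bipoly_eval (reflection a) z w) ^+ 2.

Definition expi (R : realType) (t : R) : R[i] := cos t +i* sin t.

(* Integral against normalized Lebesgue measure on the torus: with z = e^(is)
   and w = e^(it), dz/z dw/w / (2 pi i)^2 = ds dt / (2 pi)^2. *)
Definition torus_integral (R : realType) (f : R[i] -> R[i] -> R) : \bar R :=
  (((2 * pi) ^+ 2)^-1%:E *
   \int[(@lebesgue_measure R \x @lebesgue_measure R)%E]_(x in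
     `[0%R, (2 * pi)%R] `*` `[0%R, (2 * pi)%R]) (f (expi x.1) (expi x.2))%:E)%E.

(* Main.v *)
(* Sufficiency is Cauchy-Schwarz for the weight [1/|q|^2] on the torus.  For
   [z0, w0] in the open bidisk put
     [k = (q conj(q z0 w0) - q~ conj(q~ z0 w0)) / ((1 - z conj z0) (1 - w conj w0))],
   where [q~] is the reflection.  On the torus [q~ = z^n w^m conj q], and [1/q] is a
   uniform limit of polynomials on the closed bidisk, so the reproducing property of
   the Szego kernel gives [<1, k> = 1] and
     [||k||^2 = (|q z0 w0|^2 - |q~ z0 w0|^2) / ((1 - |z0|^2) (1 - |w0|^2))],
   whence [1 <= ||1||^2 ||k||^2] with [||1||^2 = 1/c].
   For necessity, let [q] vanish at a boundary point and move radially towards it.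
   If only one coordinate is unimodular, [|q|^2] is quadratic in [1 - r] whereas
   the right-hand side is linear.  If both are, then [|q|^2 - |q~|^2] is cubic, as
   [q~] has the same first-order behaviour as [q] up to a unimodular factor,
   whereas the right-hand side is quadratic. *)
Require Import Defs.
From mathcomp Require Import all_boot all_order all_algebra.
From mathcomp Require Import complex ring lra.
From mathcomp Require Import all_classical all_reals all_analysis.
From mathcomp Require Import measurable_realfun.

Set Implicit Arguments.
Unset Strict Implicit.
Unset Printing Implicit Defensive.

Import Order.TTheory GRing.Theory Num.Theory.
Import numFieldNormedType.Exports.

Local Open Scope classical_set_scope.
Local Open Scope complex_scope.
Local Open Scope ring_scope.

(* The unqualified names denote the real and imaginary parts of a [numClosedFieldType]. *)
Local Notation Re := complex.Re.
Local Notation Im := complex.Im.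

(** * Integration of bounded real functions over the torus *)

Section TorusMean.
Variable R : realType.
Local Notation C := R[i].
Local Notation leb := (@lebesgue_measure R).
Implicit Types g h : C -> C -> R.

Definition square : set (measurableTypeR R * measurableTypeR R) :=
  `[0%R, (2 * pi)%R] `*` `[0%R, (2 * pi)%R].

Definition on_angles T (g : C -> C -> T) (x : R * R) : T :=
  g (expi x.1) (expi x.2).

(** Real-valued counterpart of [torus_integral], so that ordinary field arithmetic applies;
    [torus_integralE] reconciles the two. *)
Definition torus_mean g : R :=
  ((2 * pi) ^+ 2)^-1 * \int[(leb \x leb)%E]_(x in square) on_angles g x.

(** On a square of finite measure this guarantees integrability, and it is stable under the
    algebraic operations below. Only values on the torus matter. *)
Definition bounded_measurable g : Prop :=
  measurable_fun setT (on_angles g : measurableTypeR R * measurableTypeR R -> R) /\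
  exists M, forall s t, `|g (expi s) (expi t)| <= M.

Lemma twopi_gt0 : 0 < 2 * pi :> R.
Proof. by rewrite mulr_gt0// pi_gt0. Qed.

Lemma measurable_square : measurable square.
Proof. exact: measurableX. Qed.

Lemma measure_square : (leb \x leb)%E square = ((2 * pi) ^+ 2)%:E.
Proof.
have l2pi : leb `[0%R, (2 * pi)%R]%classic = (2 * pi)%:E.
  by rewrite lebesgue_measure_itv/= lte_fin twopi_gt0 sube0.
rewrite product_measure1E//; apply: etrans (f_equal2 _ l2pi l2pi) _.
by rewrite -EFinM expr2.
Qed.

Lemma integrable_bounded_measurable g : bounded_measurable g ->
  (leb \x leb)%E.-integrable square (EFin \o on_angles g).
Proof.
move=> [mg [M gM]]; apply: measurable_bounded_integrable => //.
- exact: measurable_square.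
- by have := ltry ((2 * pi) ^+ 2 : R); rewrite -measure_square.
- exact: measurable_funTS.
- exists M; split; first exact: num_real.
  by move=> K MK x _; apply: le_trans (gM _ _) _; exact: ltW.
Qed.

Lemma torus_integralE g : bounded_measurable g ->
  torus_integral g = (torus_mean g)%:E.
Proof.
move=> ng; rewrite /torus_integral /torus_mean EFinM; congr (_ * _)%E.
rewrite /Rintegral fineK//; apply: integrable_fin_num.
  exact: measurable_square.
exact: integrable_bounded_measurable.
Qed.

Lemma bounded_measurable_cst (a : R) : bounded_measurable (fun _ _ => a).
Proof. by split; [exact: measurable_cst|exists `|a|]. Qed.

Lemma bounded_measurableD g h : bounded_measurable g -> bounded_measurable h ->
  bounded_measurable (fun z w => g z w + h z w).
Proof.
move=> [mg [M gM]] [mh [N hN]]; split; first exact: measurable_funD.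
by exists (M + N) => s t; rewrite (le_trans (ler_normD _ _))// lerD.
Qed.

Lemma bounded_measurableM g h : bounded_measurable g -> bounded_measurable h ->
  bounded_measurable (fun z w => g z w * h z w).
Proof.
move=> [mg [M gM]] [mh [N hN]]; split; first exact: measurable_funM.
by exists (M * N) => s t; rewrite normrM ler_pM.
Qed.

Lemma bounded_measurableV g d : 0 < d -> (forall s t, d <= g (expi s) (expi t)) ->
  bounded_measurable g -> bounded_measurable (fun z w => (g z w)^-1).
Proof.
move=> d0 dg [mg _]; split; last first.
  exists d^-1 => s t; rewrite normfV lef_pV2 ?posrE//.
    exact: le_trans (dg s t) (ler_norm _).
  by rewrite normr_gt0 gt_eqF//; exact: lt_le_trans d0 (dg s t).
(* As [g] is positive on the torus, its inverse there is [expR (- ln g)], whose measurability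
   follows from that of [expR] and [ln]. *)
rewrite [on_angles _](_ : _ = expR \o (\- (@ln R \o on_angles g)))//.
  apply: measurableT_comp => //; apply: measurableT_comp => //.
  exact: measurableT_comp.
apply/funext => -[s t]; rewrite /= /on_angles/= expRN lnK// posrE.
exact: lt_le_trans (dg _ _).
Qed.

Lemma torus_meanD g h : bounded_measurable g -> bounded_measurable h ->
  torus_mean (fun z w => g z w + h z w) = torus_mean g + torus_mean h.
Proof.
move=> ng nh; rewrite /torus_mean -mulrDr -RintegralD//.
- exact: measurable_square.
- exact: integrable_bounded_measurable.
- exact: integrable_bounded_measurable.
Qed.

Lemma torus_meanZ a g : bounded_measurable g ->
  torus_mean (fun z w => a * g z w) = a * torus_mean g.
Proof.
move=> ng; rewrite /torus_mean [RHS]mulrCA; congr (_ * _).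
apply: RintegralZl; first exact: measurable_square.
exact: integrable_bounded_measurable.
Qed.

Lemma torus_mean_cst a : torus_mean (fun _ _ => a) = a.
Proof.
rewrite /torus_mean Rintegral_cst; last exact: measurable_square.
rewrite (congr1 fine measure_square).
by rewrite /= mulrCA mulVf ?mulr1// sqrf_eq0 gt_eqF// twopi_gt0.
Qed.

Lemma le_torus_mean g h : bounded_measurable g -> bounded_measurable h ->
  (forall s t, g (expi s) (expi t) <= h (expi s) (expi t)) ->
  torus_mean g <= torus_mean h.
Proof.
move=> ng nh gh; rewrite /torus_mean ler_pM2l ?invr_gt0 ?exprn_gt0 ?twopi_gt0//.
apply: le_Rintegral.
- exact: measurable_square.
- exact: integrable_bounded_measurable.
- exact: integrable_bounded_measurable.
- by move=> x _; apply: gh.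
Qed.

Lemma eq_torus_mean g h :
  (forall s t, g (expi s) (expi t) = h (expi s) (expi t)) ->
  torus_mean g = torus_mean h.
Proof.
by move=> gh; rewrite /torus_mean; congr (_ * _); apply: eq_Rintegral => x _; apply: gh.
Qed.

(** The primitive [a^-1 * sin (a * x + c)] takes equal values at both ends. The periodicity
    hypothesis stands in for integrality of [a], which may be negative. *)
Lemma integral_cos_period (a c : R) : a != 0 ->
  (forall t, sin (t + a * (2 * pi)) = sin t) ->
  (\int[leb]_(x in `[0%R, (2 * pi)%R]) (cos (a * x + c))%:E = 0)%E.
Proof.
move=> a0 per.
have dF (x : R) : is_derive x 1 (fun x => a^-1 * sin (a * x + c)) (cos (a * x + c)).
  apply: is_derive_eq.
  by rewrite /GRing.scale/= !(mulr0,mulr1,addr0,add0r); field.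
have ccos : continuous (fun x => cos (a * x + c) : R).
  move=> x; apply: (@continuous_comp _ _ _ (fun x => a * x + c) cos).
    apply: cvgD; last exact: cvg_cst.
    by apply: cvgM; [exact: cvg_cst|exact: cvg_id].
  exact: continuous_cos.
have cF : continuous (fun x => a^-1 * sin (a * x + c) : R).
  move=> x; apply: differentiable_continuous; apply/derivable1_diffP.
  exact: (@ex_derive _ _ _ _ _ _ _ (dF x)).
rewrite (@continuous_FTC2 _ _ (fun x => a^-1 * sin (a * x + c))) ?twopi_gt0//.
- by rewrite /= mulr0 add0r [_ + c]addrC per -EFinB subrr.
- exact/continuous_subspaceT.
- split.
  + by move=> x _; exact: (@ex_derive _ _ _ _ _ _ _ (dF x)).
  + by apply: cvg_at_right_filter; exact: cF.
  + by apply: cvg_at_left_filter; exact: cF.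
- by move=> x _; rewrite derive1E; exact: (@derive_val _ _ _ _ _ _ _ (dF x)).
Qed.

Lemma measurable_cos : measurable_fun setT (@cos R : measurableTypeR R -> R).
Proof. by apply: continuous_measurable_fun; exact: continuous_cos. Qed.

Lemma measurable_sin : measurable_fun setT (@sin R : measurableTypeR R -> R).
Proof. by apply: continuous_measurable_fun; exact: continuous_sin. Qed.

(** Real form of a character of the torus: [c = 0] gives cosines and [c = - (pi / 2)] gives
    sines. *)
Definition phase (a b c : R) (x : measurableTypeR R * measurableTypeR R) : R :=
  cos (a * x.1 + b * x.2 + c).

Lemma measurable_phase (a b c : R) : measurable_fun setT (phase a b c).
Proof.
apply: (measurableT_comp measurable_cos).
apply: measurable_funD => //; apply: measurable_funD.
  exact: (measurable_funM (measurable_cst _) measurable_fst).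
exact: (measurable_funM (measurable_cst _) measurable_snd).
Qed.

(** Extension by zero to the whole plane puts the integrand into the form needed for Fubini's
    theorem. *)
Lemma integrable_phase a b c :
  (leb \x leb)%E.-integrable setT ((EFin \o phase a b c) \_ square).
Proof.
apply/(integrable_mkcond _ measurable_square).
apply: measurable_bounded_integrable => //.
- exact: measurable_square.
- by have := ltry ((2 * pi) ^+ 2 : R); rewrite -measure_square.
- apply: measurable_funTS; exact: measurable_phase.
- exists 1; split; first exact: num_real.
  by move=> K K1 x _; apply: le_trans (cos_max _) _; exact: ltW.
Qed.

(** By Fubini, the inner integral over the first angle is already zero, since the second angle only
    shifts the phase. *)
Lemma integral_phase_fst (a b c : R) : a != 0 ->
  (forall t, sin (t + a * (2 * pi)) = sin t) ->
  (\int[(leb \x leb)%E]_(x in square) (phase a b c x)%:E = 0)%E.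
Proof.
move=> a0 per; rewrite integral_mkcond.
rewrite -integral21_prod_meas1; last exact: integrable_phase.
apply: integral0_eq => y _.
have [y2|y2] := boolP (y \in `[0%R, (2 * pi)%R]%classic); last first.
  apply: integral0_eq => x _; rewrite patchE ifF//.
  by apply/negbTE/negP => /set_mem[_ /= ?]; move/negP: y2; apply; exact: mem_set.
rewrite -[RHS](integral_cos_period (b * y + c) a0 per) [RHS]integral_mkcond.
apply: eq_integral => x _; rewrite !patchE.
have -> : ((x, y) \in square) = (x \in `[0%R, (2 * pi)%R]%classic).
  apply/idP/idP => [/set_mem[xI _]|/set_mem xI]; apply: mem_set => //.
  by split=> //; exact: set_mem.
by rewrite /= /phase addrA.
Qed.

Lemma integral_phase_snd (a b c : R) : b != 0 ->
  (forall t, sin (t + b * (2 * pi)) = sin t) ->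
  (\int[(leb \x leb)%E]_(x in square) (phase a b c x)%:E = 0)%E.
Proof.
move=> b0 per; rewrite integral_mkcond.
rewrite -integral12_prod_meas1; last exact: integrable_phase.
apply: integral0_eq => x _.
have [x2|x2] := boolP (x \in `[0%R, (2 * pi)%R]%classic); last first.
  apply: integral0_eq => y _; rewrite patchE ifF//.
  by apply/negbTE/negP => /set_mem[/= ? _]; move/negP: x2; apply; exact: mem_set.
rewrite -[RHS](integral_cos_period (a * x + c) b0 per) [RHS]integral_mkcond.
apply: eq_integral => y _; rewrite !patchE.
have -> : ((x, y) \in square) = (y \in `[0%R, (2 * pi)%R]%classic).
  apply/idP/idP => [/set_mem[_ yI]|/set_mem yI]; apply: mem_set => //.
  by split=> //; exact: set_mem.
by rewrite /= /phase addrCA addrA.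
Qed.

End TorusMean.

(** * Modulus, conjugation and unimodular exponentials *)

Section ComplexPreliminaries.
Variable R : realType.
Local Notation C := R[i].
Implicit Types x y : C.

Lemma RecD x y : Re (x + y) = Re x + Re y. Proof. by case: x => a b; case: y. Qed.
Lemma ImcD x y : Im (x + y) = Im x + Im y. Proof. by case: x => a b; case: y. Qed.
Lemma RecM x y : Re (x * y) = Re x * Re y - Im x * Im y.
Proof. by case: x => a b; case: y. Qed.
Lemma ImcM x y : Im (x * y) = Re x * Im y + Im x * Re y.
Proof. by case: x => a b; case: y. Qed.
Lemma Rec_conj x : Re x^* = Re x. Proof. by case: x. Qed.
Lemma Imc_conj x : Im x^* = - Im x. Proof. by case: x. Qed.

Lemma normc_ge0 x : 0 <= normc x. Proof. by case: x => a b; exact: sqrtr_ge0. Qed.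

Lemma sqr_normcE x : normc x ^+ 2 = Re x ^+ 2 + Im x ^+ 2.
Proof. by case: x => a b; rewrite sqr_sqrtr// addr_ge0// sqr_ge0. Qed.

Lemma mulc_conj x : x * x^* = (normc x ^+ 2)%:C.
Proof.
apply/eqP; rewrite sqr_normcE eq_complex RecM ImcM !Rec_conj !Imc_conj /=.
by apply/andP; split; apply/eqP; ring.
Qed.

Lemma normc_conj x : normc x^* = normc x.
Proof. by case: x => a b /=; rewrite sqrrN. Qed.

Lemma normcX x n : normc (x ^+ n) = normc x ^+ n.
Proof. by elim: n => [|n IH]; rewrite ?normc1// !exprS normcM IH. Qed.

Lemma normc_eq0 x : (normc x == 0) = (x == 0).
Proof. by apply/eqP/eqP => [/eq0_normc|->]//; rewrite normc0. Qed.

Lemma normc_gt0 x : (0 < normc x) = (x != 0).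
Proof. by rewrite lt_neqAle normc_ge0 andbT eq_sym normc_eq0. Qed.

Lemma normc_real (r : R) : normc r%:C = `|r|.
Proof. by rewrite /= expr0n addr0 sqrtr_sqr. Qed.

Lemma normc_Re x : `|Re x| <= normc x.
Proof.
by case: x => a b /=; rewrite -sqrtr_sqr ler_wsqrtr// lerDl sqr_ge0.
Qed.

Lemma normc_Im x : `|Im x| <= normc x.
Proof.
by case: x => a b /=; rewrite -sqrtr_sqr ler_wsqrtr// lerDr sqr_ge0.
Qed.

Lemma normc_ReIm x : normc x <= `|Re x| + `|Im x|.
Proof.
rewrite -[leRHS]ger0_norm ?addr_ge0// -sqrtr_sqr; case: x => a b /=.
rewrite ler_wsqrtr// sqrrD !real_normK ?num_real// -addrA.
by rewrite lerD2l lerDr mulrn_wge0// mulr_ge0.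
Qed.

Lemma normc_dist x y : normc x <= normc y + normc (x - y).
Proof. by rewrite -{1}[x](subrK y) addrC le_normcD. Qed.

Lemma expiD (s t : R) : expi (s + t) = expi s * expi t.
Proof. by rewrite /expi cosD sinD; apply/eqP; rewrite eq_complex /= eqxx/= addrC. Qed.

Lemma expi0 : expi (0 : R) = 1.
Proof. by rewrite /expi cos0 sin0. Qed.

Lemma normc_expi (s : R) : normc (expi s) = 1.
Proof. by rewrite /= cos2Dsin2 sqrtr1. Qed.

Lemma expi_conj (s : R) : (expi s)^* = expi (- s).
Proof. by rewrite /expi cosN sinN. Qed.

Lemma expiX (s : R) n : expi s ^+ n = expi (n%:R * s).
Proof.
elim: n => [|n IH]; first by rewrite mul0r expi0.
by rewrite exprS IH -expiD -natr1 mulrDl mul1r addrC.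
Qed.

End ComplexPreliminaries.

(** * Complex means and orthonormality of monomials *)

Section ComplexTorusMean.
Variable R : realType.
Local Notation C := R[i].
Implicit Types f g : C -> C -> C.

Definition cmean f : C :=
  torus_mean (fun z w => Re (f z w)) +i* torus_mean (fun z w => Im (f z w)).

Definition cbounded f : Prop :=
  bounded_measurable (fun z w => Re (f z w)) /\
  bounded_measurable (fun z w => Im (f z w)).

Lemma bounded_measurable_eq (g h : C -> C -> R) :
  (forall z w, g z w = h z w) -> bounded_measurable g -> bounded_measurable h.
Proof. by move=> gh; have -> : h = g by apply/funext => z; apply/funext => w. Qed.

Lemma cbounded_eq f g : (forall z w, f z w = g z w) -> cbounded f -> cbounded g.
Proof. by move=> gh; have -> : g = f by apply/funext => z; apply/funext => w. Qed.

Lemma cbounded_cst (a : C) : cbounded (fun _ _ => a).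
Proof. by split; exact: bounded_measurable_cst. Qed.

Lemma cboundedD f g : cbounded f -> cbounded g -> cbounded (fun z w => f z w + g z w).
Proof.
move=> [rf mf] [rg mg]; split.
  by apply: bounded_measurable_eq (bounded_measurableD rf rg) => z w; rewrite RecD.
by apply: bounded_measurable_eq (bounded_measurableD mf mg) => z w; rewrite ImcD.
Qed.

Lemma cboundedM f g : cbounded f -> cbounded g -> cbounded (fun z w => f z w * g z w).
Proof.
move=> [rf mf] [rg mg].
have nmf := bounded_measurableM (bounded_measurable_cst (-1)) mf.
split.
  apply: bounded_measurable_eq
    (bounded_measurableD (bounded_measurableM rf rg) (bounded_measurableM nmf mg)).
  by move=> z w; rewrite RecM mulN1r mulNr.
apply: bounded_measurable_eq
  (bounded_measurableD (bounded_measurableM rf mg) (bounded_measurableM mf rg)).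
by move=> z w; rewrite ImcM.
Qed.

Lemma cbounded_conj f : cbounded f -> cbounded (fun z w => (f z w)^*).
Proof.
move=> [rf mf]; split.
  by apply: bounded_measurable_eq rf => z w; rewrite Rec_conj.
apply: bounded_measurable_eq (bounded_measurableM (bounded_measurable_cst (-1)) mf).
by move=> z w; rewrite Imc_conj mulN1r.
Qed.

Lemma cbounded_fst : cbounded (fun z _ => z).
Proof.
split; split.
- exact: (measurableT_comp (@measurable_cos R) measurable_fst).
- by exists 1 => s t; exact: cos_max.
- exact: (measurableT_comp (@measurable_sin R) measurable_fst).
- by exists 1 => s t; exact: sin_max.
Qed.

Lemma cbounded_snd : cbounded (fun _ w => w).
Proof.
split; split.
- exact: (measurableT_comp (@measurable_cos R) measurable_snd).
- by exists 1 => s t; exact: cos_max.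
- exact: (measurableT_comp (@measurable_sin R) measurable_snd).
- by exists 1 => s t; exact: sin_max.
Qed.

Lemma cboundedX f n : cbounded f -> cbounded (fun z w => f z w ^+ n).
Proof.
move=> bf; elim: n => [|n IH]; first exact: cbounded_cst.
by apply: cbounded_eq (cboundedM bf IH) => z w; rewrite exprS.
Qed.

Lemma cbounded_sum (I : Type) (r : seq I) (F : I -> C -> C -> C) :
  (forall i, cbounded (F i)) -> cbounded (fun z w => \sum_(i <- r) F i z w).
Proof.
move=> bF; elim: r => [|i r IH].
  by apply: cbounded_eq (cbounded_cst 0) => z w; rewrite big_nil.
by apply: cbounded_eq (cboundedD (bF i) IH) => z w; rewrite big_cons.
Qed.

(** The identity [1 / f = conj f / |f|^2] reduces inversion to the real case. *)
Lemma cboundedV f d : 0 < d -> (forall s t, d <= normc (f (expi s) (expi t))) ->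
  cbounded f -> cbounded (fun z w => (f z w)^-1).
Proof.
move=> d0 df bf.
have [rf mf] := bf.
have nf : bounded_measurable (fun z w => (normc (f z w) ^+ 2)^-1).
  apply: (@bounded_measurableV _ _ (d ^+ 2)).
  - exact: exprn_gt0.
  - by move=> s t; rewrite ler_sqr ?nnegrE ?normc_ge0// ltW.
  - apply: bounded_measurable_eq
      (bounded_measurableD (bounded_measurableM rf rf) (bounded_measurableM mf mf)).
    by move=> z w; rewrite sqr_normcE !expr2.
have cnf : cbounded (fun z w => ((normc (f z w) ^+ 2)^-1)%:C).
  by split => //; exact: bounded_measurable_cst.
apply: cbounded_eq (cboundedM cnf (cbounded_conj bf)) => z w.
(* [cbounded_eq] asks for equality everywhere, even at zeros of [f]; there both sides are 0 since
   [0^-1 = 0]. *)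
have [->|f0] := eqVneq (f z w) 0; first by rewrite conjC0 mulr0 invr0.
apply: (mulfI f0); rewrite mulrCA mulc_conj divff// -rmorphM/= mulVf//.
by rewrite sqrf_eq0 normc_eq0.
Qed.

Lemma eq_cmean f g : (forall s t, f (expi s) (expi t) = g (expi s) (expi t)) ->
  cmean f = cmean g.
Proof. by move=> fg; congr (_ +i* _); apply: eq_torus_mean => s t; rewrite fg. Qed.

Lemma cmeanD f g : cbounded f -> cbounded g ->
  cmean (fun z w => f z w + g z w) = cmean f + cmean g.
Proof.
move=> [rf mf] [rg mg]; rewrite /cmean; apply/eqP; rewrite eq_complex/=.
by rewrite -!torus_meanD//; apply/andP; split; apply/eqP;
  apply: eq_torus_mean => s t; rewrite ?RecD ?ImcD.
Qed.

Lemma cmeanZ (a : C) f : cbounded f -> cmean (fun z w => a * f z w) = a * cmean f.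
Proof.
move=> [rf mf]; rewrite /cmean; apply/eqP; rewrite eq_complex/=.
case: a => a b /=; rewrite -mulNr -!torus_meanZ// -!torus_meanD//;
  try exact: (bounded_measurableM (bounded_measurable_cst _)).
by apply/andP; split; apply/eqP; apply: eq_torus_mean => s t;
  rewrite ?RecM ?ImcM ?mulNr.
Qed.

Lemma cmean_conj f : cbounded f -> cmean (fun z w => (f z w)^*) = (cmean f)^*.
Proof.
move=> [rf mf]; rewrite /cmean; apply/eqP; rewrite eq_complex/=.
rewrite -[- torus_mean _]mulN1r -torus_meanZ//.
by apply/andP; split; apply/eqP; apply: eq_torus_mean => s t;
  rewrite ?Rec_conj ?Imc_conj ?mulN1r.
Qed.

Lemma cmean_cst (a : C) : cmean (fun _ _ => a) = a.
Proof. by rewrite /cmean !torus_mean_cst; case: a. Qed.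

Lemma cmean_sum (I : Type) (r : seq I) (F : I -> C -> C -> C) :
  (forall i, cbounded (F i)) ->
  cmean (fun z w => \sum_(i <- r) F i z w) = \sum_(i <- r) cmean (F i).
Proof.
move=> bF; elim: r => [|i r IH].
  rewrite big_nil -[RHS](cmean_cst 0).
  by apply: eq_cmean => s t; rewrite big_nil.
rewrite big_cons -IH -cmeanD//; last exact: cbounded_sum.
by apply: eq_cmean => s t; rewrite big_cons.
Qed.

Lemma torus_mean_bound (g : C -> C -> R) M : bounded_measurable g ->
  (forall s t, `|g (expi s) (expi t)| <= M) -> `|torus_mean g| <= M.
Proof.
move=> bg gM; rewrite ler_norml; apply/andP; split.
  rewrite -[leLHS]torus_mean_cst; apply: le_torus_mean => //.
    exact: bounded_measurable_cst.
  by move=> s t; have := gM s t; rewrite ler_norml => /andP[].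
rewrite -[leRHS]torus_mean_cst; apply: le_torus_mean => //.
  exact: bounded_measurable_cst.
by move=> s t; have := gM s t; rewrite ler_norml => /andP[].
Qed.

(** Real and imaginary parts are bounded separately, hence the factor 2. It is harmless, because the
    bound only serves to let errors tend to 0. *)
Lemma cmean_bound f M : cbounded f ->
  (forall s t, normc (f (expi s) (expi t)) <= M) -> normc (cmean f) <= 2 * M.
Proof.
move=> [rf mf] fM; apply: (le_trans (normc_ReIm _)).
rewrite mulr_natl mulr2n /cmean/=; apply: lerD; apply: torus_mean_bound => // s t.
  exact: le_trans (normc_Re _) (fM s t).
exact: le_trans (normc_Im _) (fM s t).
Qed.

Lemma torus_mean_phase (g : C -> C -> R) (a b c : R) :
  (forall s t, g (expi s) (expi t) = cos (a * s + b * t + c)) ->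
  (a != 0) || (b != 0) ->
  (forall t, sin (t + a * (2 * pi)) = sin t) ->
  (forall t, sin (t + b * (2 * pi)) = sin t) ->
  torus_mean g = 0.
Proof.
move=> gE ab0 pa pb; rewrite /torus_mean /Rintegral.
have -> : on_angles g = phase a b c by apply/funext => -[s t]; exact: gE.
case/orP: ab0 => [a0|b0]; first by rewrite integral_phase_fst//= mulr0.
by rewrite integral_phase_snd//= mulr0.
Qed.

Lemma sin_periodn (x : R) n : sin (x + n%:R * (2 * pi)) = sin x.
Proof.
elim: n => [|n IH]; first by rewrite mul0r addr0.
rewrite -natr1 mulrDl mul1r addrA -[RHS]IH.
by have := sinD2pi (x + n%:R * (2 * pi)); rewrite -[pi *+ 2]mulr_natl => ->.
Qed.

(** Differences of naturals cover every integer frequency, negative ones included. *)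
Lemma sin_periodB (x : R) j k : sin (x + (j%:R - k%:R) * (2 * pi)) = sin x.
Proof. by rewrite -(sin_periodn _ k) mulrBl addrA subrK sin_periodn. Qed.

Lemma cmean_expi f (a b : R) :
  (forall s t, f (expi s) (expi t) = expi (a * s + b * t)) ->
  (a != 0) || (b != 0) ->
  (forall t, sin (t + a * (2 * pi)) = sin t) ->
  (forall t, sin (t + b * (2 * pi)) = sin t) ->
  cmean f = 0.
Proof.
move=> fE ab0 pa pb; apply/eqP; rewrite eq_complex/=; apply/andP; split; apply/eqP.
  by apply: (@torus_mean_phase _ a b 0) => // s t; rewrite fE addr0.
(* The imaginary part is a sine, that is, a cosine shifted by [- (pi / 2)]. *)
by apply: (@torus_mean_phase _ a b (- (pi / 2))) => // s t; rewrite fE cosBpihalf.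
Qed.

(** On the torus the integrand is the character of frequencies [j - a] and [k - b], which has mean
    zero unless both vanish. *)
Lemma cmean_monomial j k a b :
  cmean (fun z w => z ^+ j * w ^+ k * (z ^+ a * w ^+ b)^*) =
  ((j == a) && (k == b))%:R.
Proof.
have [/andP[/eqP-> /eqP->]|ab] := boolP ((j == a) && (k == b)).
  rewrite -[RHS]cmean_cst; apply: eq_cmean => s t.
  by rewrite mulc_conj normcM !normcX !normc_expi !expr1n mulr1 expr1n.
apply: (@cmean_expi _ (j%:R - a%:R) (k%:R - b%:R)).
- move=> s t; rewrite !expiX -expiD -expiD expi_conj -expiD; congr expi; ring.
- by rewrite !subr_eq0 !eqr_nat -negb_and.
- by move=> t; exact: sin_periodB.
- by move=> t; exact: sin_periodB.
Qed.

End ComplexTorusMean.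

(** * Uniform polynomial approximation on the closed bidisk *)

Section PolynomialApproximation.
Variable R : realType.
Local Notation C := R[i].
Implicit Types f g h q : C -> C -> C.

(** Generated by the ring operations, so that bounds, Lipschitz estimates and continuity follow by
    induction. *)
Inductive polyfun : (C -> C -> C) -> Prop :=
| polyfun_cst c : polyfun (fun _ _ => c)
| polyfun_fst : polyfun (fun z _ => z)
| polyfun_snd : polyfun (fun _ w => w)
| polyfunD f g : polyfun f -> polyfun g -> polyfun (fun z w => f z w + g z w)
| polyfunM f g : polyfun f -> polyfun g -> polyfun (fun z w => f z w * g z w).

Lemma polyfun_eq f g : (forall z w, f z w = g z w) -> polyfun f -> polyfun g.
Proof. by move=> gh; have -> : g = f by apply/funext => z; apply/funext => w. Qed.

Lemma polyfun_comp f g h : polyfun f -> polyfun g -> polyfun h ->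
  polyfun (fun z w => f (g z w) (h z w)).
Proof.
move=> pf pg ph; elim: pf => [c|||{}f f' _ IHf _ IHg|{}f f' _ IHf _ IHg] //.
- exact: polyfun_cst.
- exact: polyfunD.
- exact: polyfunM.
Qed.

Lemma polyfun_scale f (r : R) : polyfun f -> polyfun (fun z w => f (r%:C * z) (r%:C * w)).
Proof.
move=> pf; apply: (polyfun_comp pf); apply: polyfunM; try exact: polyfun_cst.
  exact: polyfun_fst.
exact: polyfun_snd.
Qed.

Lemma polyfunX f n : polyfun f -> polyfun (fun z w => f z w ^+ n).
Proof.
move=> pf; elim: n => [|n IH]; first exact: polyfun_cst.
by apply: polyfun_eq (polyfunM pf IH) => z w; rewrite exprS.
Qed.

Lemma polyfunB f g : polyfun f -> polyfun g -> polyfun (fun z w => f z w - g z w).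
Proof.
move=> pf pg; apply: polyfun_eq (polyfunD pf (polyfunM (polyfun_cst (-1)) pg)).
by move=> z w; rewrite mulN1r.
Qed.

Lemma polyfun_sum (I : Type) (r : seq I) (F : I -> C -> C -> C) :
  (forall i, polyfun (F i)) -> polyfun (fun z w => \sum_(i <- r) F i z w).
Proof.
move=> bF; elim: r => [|i r IH].
  by apply: polyfun_eq (polyfun_cst 0) => z w; rewrite big_nil.
by apply: polyfun_eq (polyfunD (bF i) IH) => z w; rewrite big_cons.
Qed.

Lemma polyfun_bipoly n m (a : 'M[C]_(n.+1, m.+1)) : polyfun (bipoly_eval a).
Proof.
apply: polyfun_sum => j; apply: polyfun_sum => k.
apply: polyfunM; last exact: (polyfunX _ polyfun_snd).
by apply: polyfunM; [exact: polyfun_cst|exact: (polyfunX _ polyfun_fst)].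
Qed.

Lemma polyfun_monomials f : polyfun f ->
  exists s : seq (C * (nat * nat)),
    forall z w, f z w = \sum_(i <- s) i.1 * (z ^+ i.2.1 * w ^+ i.2.2).
Proof.
elim=> [c|||{}f g _ [s sE] _ [t tE]|{}f g _ [s sE] _ [t tE]].
- by exists [:: (c, (0, 0)%N)] => z w; rewrite big_seq1/= !expr0 !mulr1.
- by exists [:: (1, (1, 0)%N)] => z w; rewrite big_seq1/= expr0 expr1 mulr1 mul1r.
- by exists [:: (1, (0, 1)%N)] => z w; rewrite big_seq1/= expr0 expr1 !mul1r.
- by exists (s ++ t) => z w; rewrite big_cat sE tE.
- exists [seq (i.1 * j.1, (i.2.1 + j.2.1, i.2.2 + j.2.2)%N) | i <- s, j <- t].
  move=> z w; rewrite big_allpairs_dep sE tE big_distrlr/=.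
  apply: eq_bigr => i _; apply: eq_bigr => j _.
  by rewrite !exprD; ring.
Qed.

Lemma polyfun_cbounded f : polyfun f -> cbounded f.
Proof.
elim=> [c|||{}f g _ IHf _ IHg|{}f g _ IHf _ IHg].
- exact: cbounded_cst.
- exact: cbounded_fst.
- exact: cbounded_snd.
- exact: cboundedD.
- exact: cboundedM.
Qed.

Lemma polyfun_bounded f : polyfun f ->
  exists2 M, 0 < M & forall z w, normc z <= 1 -> normc w <= 1 -> normc (f z w) <= M.
Proof.
elim=> [c|||{}f g _ [M M0 fM] _ [N N0 gN]|{}f g _ [M M0 fM] _ [N N0 gN]].
- by exists (normc c + 1); [rewrite ltr_wpDl// normc_ge0|move=> *; rewrite lerDl].
- by exists 1.
- by exists 1.
- exists (M + N); first exact: addr_gt0.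
  by move=> z w z1 w1; rewrite (le_trans (le_normcD _ _))// lerD// ?fM ?gN.
- exists (M * N); first exact: mulr_gt0.
  by move=> z w z1 w1; rewrite normcM ler_pM ?normc_ge0// ?fM ?gN.
Qed.

(** Supplies the step size for the continuation in [approxV]. Products are handled by changing one
    factor at a time. *)
Lemma polyfun_lipschitz f : polyfun f ->
  exists2 L, 0 < L & forall z w z' w', normc z <= 1 -> normc w <= 1 ->
    normc z' <= 1 -> normc w' <= 1 ->
    normc (f z w - f z' w') <= L * (normc (z - z') + normc (w - w')).
Proof.
elim=> [c|||{}f g pf [L L0 fL] pg [L' L'0 gL]|{}f g pf [L L0 fL] pg [L' L'0 gL]].
- by exists 1 => // z w z' w' *; rewrite subrr normc0 mul1r addr_ge0 ?normc_ge0.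
- by exists 1 => // z w z' w' *; rewrite mul1r lerDl normc_ge0.
- by exists 1 => // z w z' w' *; rewrite mul1r lerDr normc_ge0.
- exists (L + L'); first exact: addr_gt0.
  move=> z w z' w' z1 w1 z1' w1'; rewrite opprD addrACA mulrDl.
  by rewrite (le_trans (le_normcD _ _))// lerD// ?fL ?gL.
- have [M M0 fM] := polyfun_bounded pf; have [N N0 gN] := polyfun_bounded pg.
  exists (L * N + M * L'); first by rewrite addr_gt0// mulr_gt0.
  move=> z w z' w' z1 w1 z1' w1'; set D := _ + normc (w - w').
  have -> : f z w * g z w - f z' w' * g z' w' =
    (f z w - f z' w') * g z w + f z' w' * (g z w - g z' w') by ring.
  rewrite (le_trans (le_normcD _ _))// [leRHS]mulrDl; apply: lerD; rewrite normcM.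
    by rewrite mulrAC ler_pM ?normc_ge0// ?fL ?gN.
  by rewrite -mulrA ler_pM ?normc_ge0// ?gL ?fM.
Qed.

(** Membership in the bidisk algebra, the uniform closure of the polynomials; only values on the
    closed bidisk are constrained. *)
Definition approx f : Prop :=
  forall e, 0 < e -> exists2 p, polyfun p &
    forall z w, normc z <= 1 -> normc w <= 1 -> normc (f z w - p z w) <= e.

Lemma approx_poly f : polyfun f -> approx f.
Proof. by move=> pf e e0; exists f => // z w _ _; rewrite subrr normc0 ltW. Qed.

Lemma approx_eq f g : (forall z w, normc z <= 1 -> normc w <= 1 -> f z w = g z w) ->
  approx f -> approx g.
Proof.
by move=> fg af e /af[p pp pE]; exists p => // z w z1 w1; rewrite -fg// pE.
Qed.

Lemma approx_lim f : (forall e, 0 < e -> exists2 g, approx g &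
    forall z w, normc z <= 1 -> normc w <= 1 -> normc (f z w - g z w) <= e) ->
  approx f.
Proof.
move=> H e e0; have e2 : 0 < e / 2 by rewrite divr_gt0.
have [g ag fg] := H _ e2; have [p pp gp] := ag _ e2.
exists p => // z w z1 w1; rewrite [e]splitr.
rewrite -[_ - p z w](subrKA (g z w)).
by rewrite (le_trans (le_normcD _ _))// lerD// ?fg ?gp.
Qed.

Lemma approx_bounded f : approx f ->
  exists2 M, 0 < M & forall z w, normc z <= 1 -> normc w <= 1 -> normc (f z w) <= M.
Proof.
move=> /(_ 1 ltr01)[p pp fp]; have [M M0 pM] := polyfun_bounded pp.
exists (M + 1) => [|z w z1 w1]; first exact: addr_gt0.
by rewrite (le_trans (normc_dist _ (p z w)))// lerD// ?pM ?fp.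
Qed.

Lemma approxD f g : approx f -> approx g -> approx (fun z w => f z w + g z w).
Proof.
move=> af ag e e0; have e2 : 0 < e / 2 by rewrite divr_gt0.
have [p pp fp] := af _ e2; have [q pq gq] := ag _ e2.
exists (fun z w => p z w + q z w) => [|z w z1 w1]; first exact: polyfunD.
by rewrite opprD addrACA [e]splitr (le_trans (le_normcD _ _))// lerD// ?fp ?gq.
Qed.

Lemma approxM f g : approx f -> approx g -> approx (fun z w => f z w * g z w).
Proof.
move=> af ag e e0; have e2 : 0 < e / 2 by rewrite divr_gt0.
have [N N0 gN] := approx_bounded ag.
(* [p] is fixed first, so that its bound [M] is available when the precision of [q] is chosen. *)
have [p pp fp] := af (e / 2 / N) (divr_gt0 e2 N0).
have [M M0 pM] := polyfun_bounded pp.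
have [q pq gq] := ag (e / 2 / M) (divr_gt0 e2 M0).
exists (fun z w => p z w * q z w) => [|z w z1 w1]; first exact: polyfunM.
have -> : f z w * g z w - p z w * q z w =
  (f z w - p z w) * g z w + p z w * (g z w - q z w) by ring.
rewrite [e]splitr (le_trans (le_normcD _ _))// !normcM; apply: lerD.
  rewrite -[e / 2](divfK (lt0r_neq0 N0)).
  by rewrite ler_pM ?normc_ge0// ?fp ?gN.
rewrite -[e / 2](divfK (lt0r_neq0 M0)) mulrC.
by rewrite ler_pM ?normc_ge0// ?pM ?gq.
Qed.

Lemma approxX f n : approx f -> approx (fun z w => f z w ^+ n).
Proof.
move=> af; elim: n => [|n IH]; first exact/approx_poly/polyfun_cst.
by apply: approx_eq (approxM af IH) => z w _ _; rewrite exprS.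
Qed.

Lemma approx_sum (I : Type) (r : seq I) (F : I -> C -> C -> C) :
  (forall i, approx (F i)) -> approx (fun z w => \sum_(i <- r) F i z w).
Proof.
move=> bF; elim: r => [|i r IH].
  by apply: approx_eq (approx_poly (polyfun_cst 0)) => z w; rewrite big_nil.
by apply: approx_eq (approxD (bF i) IH) => z w; rewrite big_cons.
Qed.

Lemma exists_expr_le (x e : R) : 0 <= x -> x < 1 -> 0 < e ->
  exists N, forall n, (N <= n)%N -> x ^+ n <= e.
Proof.
move=> x0 x1 e0.
have /cvgr0Pnorm_le/(_ _ e0)[N _ NE] : (fun n => x ^+ n) @ \oo --> (0 : R).
  by apply: cvg_expr; rewrite ger0_norm.
by exists N => n Nn; rewrite -[leLHS]ger0_norm ?exprn_ge0// NE.
Qed.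

Lemma geometric_sum (x : C) n : 1 - x != 0 ->
  \sum_(k < n) x ^+ k = (1 - x ^+ n) / (1 - x).
Proof.
move=> x1; have := subrX1 x n => E.
apply: (mulIf x1); rewrite divfK// mulrC -opprB mulNr -E opprB//.
Qed.

Lemma normc_1B_ge (x : C) (r : R) : normc x <= r -> 1 - r <= normc (1 - x).
Proof.
move=> xr; rewrite lerBlDr (le_trans _ (lerD (lexx _) xr))//.
by have := normc_dist 1 (1 - x); rewrite normc1 subKr.
Qed.

Lemma normc_1B_neq0 (x : C) : normc x < 1 -> 1 - x != 0.
Proof. by move=> x1; rewrite -normc_gt0 (lt_le_trans _ (normc_1B_ge (lexx _)))// subr_gt0. Qed.

(** Partial sums of the geometric series in [h] stay in the algebra and converge uniformly, the
    ratio being at most 1/2. *)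
Lemma approx_neumann f h : approx f -> approx h ->
  (forall z w, normc z <= 1 -> normc w <= 1 -> normc (h z w) <= 2^-1) ->
  approx (fun z w => f z w / (1 - h z w)).
Proof.
move=> af ah h2; apply: approx_lim => e e0.
have [M M0 fM] := approx_bounded af.
(* The remainder is [f h^n / (1 - h)], of modulus at most [M * 2^-n * 2]. *)
have e' : 0 < e / (M * 2) by rewrite divr_gt0// mulr_gt0.
have [||n nE] := @exists_expr_le 2^-1 _ _ _ e'.
- by rewrite invr_ge0.
- by rewrite invf_lt1// ltr1n.
exists (fun z w => f z w * \sum_(k < n) h z w ^+ k).
  by apply: approxM => //; apply: approx_sum => k; exact: approxX.
move=> z w z1 w1; have hz := h2 z w z1 w1.
have h1 : normc (h z w) < 1 by rewrite (le_lt_trans hz)// invf_lt1// ltr1n.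
have h1' := normc_1B_neq0 h1.
rewrite geometric_sum//.
have -> : f z w / (1 - h z w) - f z w * ((1 - h z w ^+ n) / (1 - h z w)) =
  f z w * ((h z w ^+ n) / (1 - h z w)) by field.
have -> : e = M * (e / (M * 2) / 2^-1).
  by field; rewrite lt0r_neq0.
rewrite !normcM ler_pM ?mulr_ge0 ?normc_ge0 ?fM//.
rewrite ler_pM ?normc_ge0//.
  rewrite normcX (le_trans _ (nE n _))// lerXn2r ?nnegrE ?normc_ge0// invr_ge0//.
rewrite normcV lef_pV2 ?posrE ?normc_gt0//.
by rewrite (le_trans _ (normc_1B_ge hz))//; lra.
Qed.

Lemma normc_scale_le1 (r : R) (z : C) : 0 <= r <= 1 -> normc z <= 1 -> normc (r%:C * z) <= 1.
Proof. by move=> /andP[r0 r1] z1; rewrite normcM normc_real ger0_norm// mulr_ile1 ?normc_ge0. Qed.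

(* Along the path [r |-> q (r z, r w)], the inverse at [s] is obtained from the
   inverse at a nearby [r] by a Neumann series. *)
Lemma approxV q d : polyfun q -> 0 < d ->
  (forall z w, normc z <= 1 -> normc w <= 1 -> d <= normc (q z w)) ->
  approx (fun z w => (q z w)^-1).
Proof.
move=> pq d0 dq; have [L L0 qL] := polyfun_lipschitz pq.
(* With [N >= 4 L / d], one step of length [1 / N] changes [q] by at most [2 L / N <= d / 2]. *)
pose N := (Num.truncn (4 * L / d)).+1.
have NL : 4 * L / d <= N%:R by rewrite ltW// truncnS_gt.
have N0 : 0 < N%:R :> R by rewrite ltr0n.
pose c i : R := i%:R / N%:R.
have c01 i : (i <= N)%N -> 0 <= c i <= 1.
  move=> iN; rewrite divr_ge0 ?ler0n//= ler_pdivrMr// mul1r ler_nat//.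
suff H i : (i <= N)%N -> approx (fun z w => (q ((c i)%:C * z) ((c i)%:C * w))^-1).
  apply: approx_eq (H N (leqnn _)) => z w _ _.
  by rewrite /c divff ?lt0r_neq0// rmorph1 !mul1r.
elim: i => [_|i IH iN].
  apply: approx_eq (approx_poly (polyfun_cst (q 0 0)^-1)) => z w _ _.
  by rewrite /c mul0r rmorph0 !mul0r.
have iN' := ltnW iN.
pose r := c i; pose s := c i.+1.
have r01 : 0 <= r <= 1 := c01 _ iN'.
have s01 : 0 <= s <= 1 := c01 _ iN.
pose qr z w := q (r%:C * z) (r%:C * w).
pose qs z w := q (s%:C * z) (s%:C * w).
have qr0 z w : normc z <= 1 -> normc w <= 1 -> d <= normc (qr z w).
  by move=> z1 w1; apply: dq; exact: normc_scale_le1.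
have qs0 z w : normc z <= 1 -> normc w <= 1 -> d <= normc (qs z w).
  by move=> z1 w1; apply: dq; exact: normc_scale_le1.
have ah : approx (fun z w => (qr z w - qs z w) * (qr z w)^-1).
  apply: approxM; last exact: IH.
  by apply/approx_poly/polyfunB; exact: polyfun_scale.
(* With [h = (qr - qs) / qr] one has [1 - h = qs / qr], so [qr^-1 / (1 - h)] is [qs^-1]. *)
apply: approx_eq (approx_neumann (IH iN') ah _) => z w z1 w1.
  have qrn0 : qr z w != 0 by rewrite -normc_gt0 (lt_le_trans d0)// qr0.
  have qsn0 : qs z w != 0 by rewrite -normc_gt0 (lt_le_trans d0)// qs0.
  rewrite -/r -/s -/(qr z w) -/(qs z w); field.
  by rewrite qrn0 qsn0.
have qz := qr0 z w z1 w1.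
rewrite normcM normcV ler_pdivrMr ?(lt_le_trans d0)//.
apply: le_trans (_ : d / 2 <= _); last by rewrite mulrC ler_pM2l.
have rs : normc (r%:C - s%:C) = N%:R^-1.
  rewrite -rmorphB normc_real distrC /r /s /c -mulrBl -natr1 addrAC subrr add0r mul1r.
  by rewrite gtr0_norm ?invr_gt0.
rewrite (le_trans (qL _ _ _ _ _ _ _ _))// ?normc_scale_le1//.
rewrite -!mulrBl !normcM rs -mulrDr.
have zw2 : normc z + normc w <= 2 by lra.
apply: (le_trans (_ : _ <= L * (N%:R^-1 * 2))).
  by rewrite ler_pM2l// ler_pM2l// invr_gt0.
rewrite [X in _ * X]mulrC mulrA ler_pdivrMr//.
move: NL; rewrite ler_pdivrMr//; lra.
Qed.

End PolynomialApproximation.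

(** * Lower bound for zero-free polynomials by compactness *)

Section LowerBound.
Variable R : realType.
Local Notation C := R[i].
Local Notation T := ((R * R) * (R * R))%type.

(** Points of [T], that is of real 4-space, are read as pairs of complex numbers, so that
    compactness of products of real segments applies. *)
Let fstC (x : T) : C := x.1.1 +i* x.1.2.
Let sndC (x : T) : C := x.2.1 +i* x.2.2.

Lemma polyfun_continuous (f : C -> C -> C) : polyfun f ->
  continuous (fun x : T => Re (f (fstC x) (sndC x))) /\
  continuous (fun x : T => Im (f (fstC x) (sndC x))).
Proof.
have c1 : continuous (fun x : T => x.1) by move=> x; exact: cvg_fst.
have c2 : continuous (fun x : T => x.2) by move=> x; exact: cvg_snd.
have d1 : continuous (fun x : R * R => x.1) by move=> x; exact: cvg_fst.
have d2 : continuous (fun x : R * R => x.2) by move=> x; exact: cvg_snd.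
elim=> [c|||{}f g _ [rf mf] _ [rg mg]|{}f g _ [rf mf] _ [rg mg]].
- by split=> x; exact: cvg_cst.
- by split=> x; [exact: (continuous_comp (c1 x) (d1 _))|exact: (continuous_comp (c1 x) (d2 _))].
- by split=> x; [exact: (continuous_comp (c2 x) (d1 _))|exact: (continuous_comp (c2 x) (d2 _))].
- split.
    rewrite (_ : (fun x => _) = fun x => Re (f (fstC x) (sndC x)) + Re (g (fstC x) (sndC x))).
      by move=> x; apply: cvgD; [exact: rf|exact: rg].
    by apply/funext => x; rewrite RecD.
  rewrite (_ : (fun x => _) = fun x => Im (f (fstC x) (sndC x)) + Im (g (fstC x) (sndC x))).
    by move=> x; apply: cvgD; [exact: mf|exact: mg].
  by apply/funext => x; rewrite ImcD.
- split.
    rewrite (_ : (fun x => _) = fun x => Re (f (fstC x) (sndC x)) * Re (g (fstC x) (sndC x))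
                                       - Im (f (fstC x) (sndC x)) * Im (g (fstC x) (sndC x))).
      by move=> x; apply: cvgB; apply: cvgM; [exact: rf|exact: rg|exact: mf|exact: mg].
    by apply/funext => x; rewrite RecM.
  rewrite (_ : (fun x => _) = fun x => Re (f (fstC x) (sndC x)) * Im (g (fstC x) (sndC x))
                                     + Im (f (fstC x) (sndC x)) * Re (g (fstC x) (sndC x))).
    by move=> x; apply: cvgD; apply: cvgM; [exact: rf|exact: mg|exact: mf|exact: rg].
  by apply/funext => x; rewrite ImcM.
Qed.

(* The minimum is taken over the cube containing the bidisk, after adding a
   penalty [|t| + t] that vanishes exactly when [t <= 0]. *)
Lemma polyfun_lower_bound (f : C -> C -> C) : polyfun f ->
  (forall z w, normc z <= 1 -> normc w <= 1 -> f z w != 0) ->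
  exists2 d, 0 < d & forall z w, normc z <= 1 -> normc w <= 1 -> d <= normc (f z w).
Proof.
move=> pf f0; have [cre cim] := polyfun_continuous pf.
pose t1 (x : T) : R := x.1.1 * x.1.1 + x.1.2 * x.1.2 - 1.
pose t2 (x : T) : R := x.2.1 * x.2.1 + x.2.2 * x.2.2 - 1.
pose F (x : T) : R := Re (f (fstC x) (sndC x)) * Re (f (fstC x) (sndC x)) +
                  Im (f (fstC x) (sndC x)) * Im (f (fstC x) (sndC x)).
pose g x := F x + (`|t1 x| + t1 x) + (`|t2 x| + t2 x).
have [re1 im1] := polyfun_continuous (@polyfun_fst R).
have [re2 im2] := polyfun_continuous (@polyfun_snd R).
have ct1 : continuous t1.
  move=> x; apply: cvgB; last exact: cvg_cst.
  by apply: cvgD; apply: cvgM; [exact: re1|exact: re1|exact: im1|exact: im1].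
have ct2 : continuous t2.
  move=> x; apply: cvgB; last exact: cvg_cst.
  by apply: cvgD; apply: cvgM; [exact: re2|exact: re2|exact: im2|exact: im2].
have cF : continuous F.
  by move=> x; apply: cvgD; apply: cvgM; [exact: cre|exact: cre|exact: cim|exact: cim].
have cg : continuous g.
  move=> x; apply: cvgD; [apply: cvgD; first exact: cF|];
    apply: cvgD; [apply: cvg_norm; exact: ct1|exact: ct1|apply: cvg_norm; exact: ct2|exact: ct2].
pose I := `[(-1)%R, 1%R : R]%classic.
pose K : set T := (I `*` I) `*` (I `*` I).
have cK : compact K.
  by apply: compact_setX; apply: compact_setX; exact: segment_compact.
have K0 : K !=set0.
  exists ((0, 0), (0, 0)); rewrite /K/=.
  have I0 : I 0 by rewrite /I /= in_itv/= lerN10 ler01.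
  by [].
have [x xK xmin] := compact_EVT_min K0 cK (continuous_subspaceT cg).
have FE y : F y = normc (f (fstC y) (sndC y)) ^+ 2 by rewrite sqr_normcE !expr2.
have F_ge0 y : 0 <= F y by rewrite FE sqr_ge0.
have pen (t : R) : 0 <= `|t| + t by rewrite -lerBlDr sub0r -normrN ler_norm.
have t1E y : t1 y = normc (fstC y) ^+ 2 - 1 by rewrite sqr_normcE !expr2.
have t2E y : t2 y = normc (sndC y) ^+ 2 - 1 by rewrite sqr_normcE !expr2.
have pen0 (t : R) : t <= 0 -> `|t| + t = 0 by move=> t0; rewrite ler0_norm// addNr.
(* At a zero of [g] all three nonnegative terms vanish: the two penalties put the point in the
   bidisk, where [F] is not 0. *)
have gx0 : 0 < g x.
  have g0 : 0 <= g x by apply: addr_ge0 => //; exact: addr_ge0.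
  rewrite lt_neqAle g0 andbT; apply/negP; rewrite eq_sym /g => gx.
  have := gx; rewrite paddr_eq0//; last exact: addr_ge0.
  move=> /andP[].
  rewrite paddr_eq0// => /andP[Fx p1] p2.
  have le1 (t : R) : `|t| + t == 0 -> t <= 0.
    by rewrite addr_eq0 => /eqP/esym/eqP; rewrite eqr_oppLR => /eqP ->; rewrite oppr_le0.
  have z1 : normc (fstC x) <= 1.
    by have := le1 _ p1; rewrite t1E subr_le0 expr_le1// normc_ge0.
  have w1 : normc (sndC x) <= 1.
    by have := le1 _ p2; rewrite t2E subr_le0 expr_le1// normc_ge0.
  by move: Fx; rewrite FE sqrf_eq0 normc_eq0 (negbTE (f0 _ _ z1 w1)).
(* On the bidisk the penalties vanish and [g] is [|f|^2], so the root of the minimum over the cube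
   bounds [|f|] from below. *)
exists (Num.sqrt (g x)); first by rewrite sqrtr_gt0.
move=> z w z1 w1.
have inI (y : C) : normc y <= 1 -> I (Re y) /\ I (Im y).
  move=> y1; rewrite /I /= !in_itv/= -!ler_norml.
  by rewrite !(le_trans _ y1)// ?normc_Re ?normc_Im.
have yK : ((Re z, Im z), (Re w, Im w)) \in K.
  by apply: mem_set; have [? ?] := inI z z1; have [? ?] := inI w w1.
have := xmin _ yK; rewrite {2}/g.
have zE : fstC ((Re z, Im z), (Re w, Im w)) = z by case: (z).
have wE : sndC ((Re z, Im z), (Re w, Im w)) = w by case: (w).
rewrite FE t1E t2E zE wE !pen0 ?addr0 ?subr_le0 ?expr_le1 ?normc_ge0// => gle.
by rewrite -[leRHS]ger0_norm ?normc_ge0// -sqrtr_sqr ler_wsqrtr.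
Qed.

End LowerBound.

(** * The Szego kernel and its reproducing property *)

Section ReproducingKernel.
Variable R : realType.
Local Notation C := R[i].
Implicit Types f g : C -> C -> C.

(** Reproducing kernel of the Hardy space of the torus: evaluation at [(z0, w0)] is the mean against
    its conjugate. *)
Definition szego (z0 w0 z w : C) : C := ((1 - z * z0^*) * (1 - w * w0^*))^-1.

Lemma normc_small (x : C) K : (forall e, 0 < e -> normc x <= K * e) -> x = 0.
Proof.
move=> H; apply: eq0_normc; apply/eqP; rewrite eq_le normc_ge0 andbT.
apply/ler_addgt0Pr => e e0; rewrite add0r.
have K1 : 0 < `|K| + 1 by rewrite ltr_wpDl.
have := H (e / (`|K| + 1)) (divr_gt0 e0 K1); move/le_trans; apply.
rewrite mulrCA ger_pMr// ler_pdivrMr// mul1r.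
by rewrite (le_trans (ler_norm _))// lerDl.
Qed.

Section FixedPoint.
Variables z0 w0 : C.
Hypothesis z0_lt1 : normc z0 < 1.
Hypothesis w0_lt1 : normc w0 < 1.
Local Notation K := (szego z0 w0).

Let normc_mul_conj (x y : C) : normc x <= 1 -> normc (x * y^*) <= normc y.
Proof. by move=> x1; rewrite normcM normc_conj ler_piMl ?normc_ge0. Qed.

Let szegoV_ge z w : normc z <= 1 -> normc w <= 1 ->
  (1 - normc z0) * (1 - normc w0) <= normc ((1 - z * z0^*) * (1 - w * w0^*)).
Proof.
by move=> z1 w1; rewrite normcM ler_pM ?subr_ge0 ?(ltW z0_lt1) ?(ltW w0_lt1)//;
  apply: normc_1B_ge; exact: normc_mul_conj.
Qed.

Let szegoV_gt0 : 0 < (1 - normc z0) * (1 - normc w0).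
Proof. by rewrite mulr_gt0// subr_gt0. Qed.

Let polyfun_szegoV : polyfun (fun z w => (1 - z * z0^*) * (1 - w * w0^*)).
Proof.
apply: polyfunM; apply: polyfunB; try exact: polyfun_cst.
  exact: (polyfunM (polyfun_fst R) (polyfun_cst _)).
exact: (polyfunM (polyfun_snd R) (polyfun_cst _)).
Qed.

Lemma approx_szego : approx K.
Proof. exact: (approxV polyfun_szegoV szegoV_gt0 szegoV_ge). Qed.

Lemma cbounded_szego : cbounded K.
Proof.
apply: (cboundedV szegoV_gt0) => [s t|]; last exact: polyfun_cbounded.
by apply: szegoV_ge; rewrite normc_expi.
Qed.

Let geom n (z w : C) : C := (\sum_(a < n) (z * z0^*) ^+ a) * (\sum_(b < n) (w * w0^*) ^+ b).

Let cbounded_monomial j k : cbounded (fun z w : C => z ^+ j * w ^+ k).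
Proof.
by apply: cboundedM; apply: cboundedX; [exact: cbounded_fst|exact: cbounded_snd].
Qed.

(** The conjugate of [geom] is a combination of conjugate monomials with coefficients [z0^a w0^b];
    orthonormality leaves the term [a = j], [b = k]. *)
Lemma cmean_monomial_geom j k n : (j < n)%N -> (k < n)%N ->
  cmean (fun z w => z ^+ j * w ^+ k * (geom n z w)^*) = z0 ^+ j * w0 ^+ k.
Proof.
move=> jn kn.
pose F (a b : 'I_n) (z w : C) := (z ^+ j * w ^+ k) * (z ^+ a * w ^+ b)^*.
have bF a b : cbounded (F a b).
  by apply: cboundedM => //; apply: cbounded_conj.
have bcF (a b : 'I_n) : cbounded (fun z w => z0 ^+ a * w0 ^+ b * F a b z w).
  by apply: cboundedM => //; exact: cbounded_cst.
transitivity (cmean (fun z w => \sum_(a < n) \sum_(b < n) z0 ^+ a * w0 ^+ b * F a b z w)).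
  apply: eq_cmean => s t; rewrite /geom rmorphM !rmorph_sum/= big_distrlr/= mulr_sumr.
  apply: eq_bigr => a _; rewrite mulr_sumr; apply: eq_bigr => b _.
  by rewrite /F !(rmorphM, rmorphXn)/= !exprMn !conjCK; ring.
rewrite cmean_sum => [|a]; last exact: cbounded_sum.
transitivity (\sum_(a < n) \sum_(b < n) z0 ^+ a * w0 ^+ b * ((j == a) && (k == b))%:R).
  apply: eq_bigr => a _; rewrite cmean_sum//; apply: eq_bigr => b _.
  by rewrite cmeanZ// cmean_monomial.
rewrite (bigD1 (Ordinal jn))//= [X in _ + X]big1 ?addr0; last first.
  move=> a aj; apply: big1 => b _; rewrite [j == a]eq_sym.
  have -> : (nat_of_ord a == j) = false by apply/negbTE; exact: aj.
  by rewrite mulr0.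
rewrite (bigD1 (Ordinal kn))//= [X in _ + X]big1 ?addr0; last first.
  move=> b bk; rewrite [k == b]eq_sym.
  have -> : (nat_of_ord b == k) = false by apply/negbTE; exact: bk.
  by rewrite andbF mulr0.
by rewrite !eqxx mulr1.
Qed.

Lemma szego_geom_dist e : 0 < e -> exists N, forall n, (N <= n)%N ->
  forall z w, normc z <= 1 -> normc w <= 1 -> normc (K z w - geom n z w) <= e.
Proof.
move=> e0; pose d := (1 - normc z0) * (1 - normc w0).
have d0 : 0 < d := szegoV_gt0.
(* One third for each term of [X + Y - X Y], the numerator of the remainder; [d] bounds its
   denominator from below. *)
have e1 : 0 < e * d / 3 by rewrite divr_gt0// mulr_gt0.
have [N1 N1E] := exists_expr_le (normc_ge0 z0) z0_lt1 e1.
have [N2 N2E] := exists_expr_le (normc_ge0 w0) w0_lt1 e1.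
exists (maxn N1 N2) => n; rewrite geq_max => /andP[n1 n2] z w z1 w1.
have xz : normc (z * z0^*) <= normc z0 by exact: normc_mul_conj.
have xw : normc (w * w0^*) <= normc w0 by exact: normc_mul_conj.
have nz : 1 - z * z0^* != 0 by apply: normc_1B_neq0; exact: le_lt_trans z0_lt1.
have nw : 1 - w * w0^* != 0 by apply: normc_1B_neq0; exact: le_lt_trans w0_lt1.
have qz : normc ((z * z0^*) ^+ n) <= e * d / 3.
  by rewrite normcX (le_trans _ (N1E _ n1))// lerXn2r ?nnegrE ?normc_ge0.
have qw : normc ((w * w0^*) ^+ n) <= e * d / 3.
  by rewrite normcX (le_trans _ (N2E _ n2))// lerXn2r ?nnegrE ?normc_ge0.
have qw1 : normc ((w * w0^*) ^+ n) <= 1.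
  by rewrite normcX exprn_ile1 ?normc_ge0// (le_trans xw)// ltW.
rewrite /geom !geometric_sum// /szego.
move: qz qw qw1 nz nw (szegoV_ge z1 w1); rewrite -/d.
move: ((z * z0^*) ^+ n) ((w * w0^*) ^+ n) (1 - z * z0^*) (1 - w * w0^*).
move=> X Y x y qX qY qY1 x0 y0 dxy.
have -> : (x * y)^-1 - (1 - X) / x * ((1 - Y) / y) = (X + Y - X * Y) / (x * y).
  by field; rewrite x0 y0.
rewrite normcM normcV ler_pdivrMr; last by rewrite (lt_le_trans d0).
have qXY : normc (X * Y) <= e * d / 3.
  by rewrite normcM (le_trans _ qX)// ler_piMr// normc_ge0.
apply: (le_trans (_ : _ <= e * d)); last by rewrite ler_pM2l.
have := le_normcD (X + Y) (- (X * Y)); have := le_normcD X Y; rewrite normcN.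
lra.
Qed.

Let szego_bounded : exists2 M, 0 < M &
  forall z w, normc z <= 1 -> normc w <= 1 -> normc (K z w) <= M.
Proof. exact: approx_bounded approx_szego. Qed.

(** Uniform convergence of [geom] to the kernel transfers the identity from the truncations. *)
Lemma cmean_monomial_szego j k :
  cmean (fun z w => z ^+ j * w ^+ k * (K z w)^*) = z0 ^+ j * w0 ^+ k.
Proof.
apply/eqP; rewrite -subr_eq0; apply/eqP.
apply: (@normc_small _ 2) => e e0.
have [N NE] := szego_geom_dist e0.
(* Large enough for the precision [e] and for both exponents to occur in the truncation. *)
pose n := maxn N (maxn j k).+1.
have jn : (j < n)%N by rewrite leq_max ltnS leq_maxl orbT.
have kn : (k < n)%N by rewrite leq_max ltnS leq_maxr orbT.
have bg : cbounded (geom n).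
  apply: polyfun_cbounded; apply: polyfunM; apply: polyfun_sum => i; apply: polyfunX.
    exact: (polyfunM (polyfun_fst R) (polyfun_cst _)).
  exact: (polyfunM (polyfun_snd R) (polyfun_cst _)).
have bd : cbounded (fun z w => z ^+ j * w ^+ k * (K z w - geom n z w)^*).
  apply: cboundedM => //; apply: cbounded_conj.
  have := cboundedD cbounded_szego (cboundedM (cbounded_cst (-1)) bg).
  by apply: cbounded_eq => z w; rewrite mulN1r.
have -> : cmean (fun z w => z ^+ j * w ^+ k * (K z w)^*) - z0 ^+ j * w0 ^+ k =
    cmean (fun z w => z ^+ j * w ^+ k * (K z w - geom n z w)^*).
  rewrite -(cmean_monomial_geom jn kn) -[X in X - _]addr0.
  apply/eqP; rewrite addr0 subr_eq; apply/eqP; rewrite -cmeanD//.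
    by apply: eq_cmean => s t; rewrite -mulrDr -rmorphD/= subrK.
  by apply: cboundedM => //; exact: cbounded_conj.
apply: cmean_bound => // s t.
rewrite !normcM !normcX !normc_expi !expr1n !mul1r normc_conj.
by apply: NE; rewrite ?normc_expi// leq_maxl.
Qed.

(** Linearity extends the identity from monomials to polynomials, and density extends it to the
    whole algebra. *)
Lemma cmean_szego f : approx f -> cbounded f ->
  cmean (fun z w => f z w * (K z w)^*) = f z0 w0.
Proof.
move=> af bf; apply/eqP; rewrite -subr_eq0; apply/eqP.
have [M M0 KM] := szego_bounded.
(* [2 * M] comes from the mean of [f - p] against the kernel, and 1 from the error at [(z0, w0)]. *)
apply: (@normc_small _ (2 * M + 1)) => e e0.
have [p pp fp] := af _ e0.
have bK := cbounded_conj cbounded_szego.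
have pE : cmean (fun z w => p z w * (K z w)^*) = p z0 w0.
  have [s sE] := polyfun_monomials pp.
  pose F (i : C * (nat * nat)) (z w : C) := z ^+ i.2.1 * w ^+ i.2.2 * (K z w)^*.
  have bF i : cbounded (F i) by exact: cboundedM.
  transitivity (cmean (fun z w => \sum_(i <- s) i.1 * F i z w)).
    apply: eq_cmean => u v; rewrite sE mulr_suml.
    by apply: eq_bigr => i _; rewrite /F !mulrA.
  rewrite cmean_sum => [|i]; last by apply: cboundedM => //; exact: cbounded_cst.
  rewrite sE; apply: eq_bigr => i _.
  by rewrite cmeanZ// cmean_monomial_szego.
have bp := polyfun_cbounded pp.
have bd : cbounded (fun z w => (f z w - p z w) * (K z w)^*).
  apply: cboundedM => //.
  have := cboundedD bf (cboundedM (cbounded_cst (-1)) bp).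
  by apply: cbounded_eq => z w; rewrite mulN1r.
have -> : cmean (fun z w => f z w * (K z w)^*) =
    cmean (fun z w => (f z w - p z w) * (K z w)^*) + p z0 w0.
  rewrite -pE -cmeanD//; last exact: cboundedM.
  by apply: eq_cmean => s t; rewrite -mulrDl subrK.
rewrite -addrA (le_trans (le_normcD _ _))// mulrDl mul1r; apply: lerD.
  rewrite -mulrA; apply: cmean_bound => // s t.
  by rewrite normcM normc_conj mulrC ler_pM ?normc_ge0 ?KM ?fp ?normc_expi.
by rewrite -normcN opprB fp// ltW.
Qed.

End FixedPoint.

(** Mean value property, obtained because the kernel at the origin is the constant 1. *)
Lemma cmean_approx f : approx f -> cbounded f -> cmean f = f 0 0.
Proof.
move=> af bf; rewrite -(@cmean_szego 0 0 _ _ f af bf) ?normc0//.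
apply: eq_cmean => s t.
by rewrite /szego conjC0 !mulr0 subr0 mulr1 invr1 conjC1 mulr1.
Qed.

End ReproducingKernel.

(** * The inequality for a zero-free polynomial *)

Section Forward.
Variable R : realType.
Local Notation C := R[i].
Variables (n m : nat) (a : 'M[C]_(n.+1, m.+1)).
Local Notation q := (bipoly_eval a).
Local Notation qr := (bipoly_eval (reflection a)).

Lemma conj_real (r : R) : (r%:C)^* = r%:C.
Proof. by apply/eqP; rewrite eq_complex Rec_conj Imc_conj /= oppr0 !eqxx. Qed.

(** On the circle [1 / conj z = z], so the reflection involves [q] at the same point. *)
Lemma reflection_torus (z w : C) : normc z = 1 -> normc w = 1 ->
  qr z w = z ^+ n * w ^+ m * (q z w)^*.
Proof.
have H (x : C) : normc x = 1 -> (x != 0) * ((x^*)^-1 = x).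
  move=> x1; have x0 : x != 0 by rewrite -normc_gt0 x1.
  split=> //; apply: (mulIf (_ : x^* != 0)); first by rewrite conjC_eq0.
  by rewrite mulVf ?conjC_eq0// mulc_conj x1 expr1n.
by move=> /H[z0 zE] /H[w0 wE]; rewrite reflectionE// zE wE.
Qed.

Hypothesis q_neq0 : zero_free_closed_bidisk a.

Local Notation S := (torus_mean (fun z w => (normc (q z w) ^+ 2)^-1)).

Lemma bipoly_lower_bound : exists2 d, 0 < d &
  forall z w, normc z <= 1 -> normc w <= 1 -> d <= normc (q z w).
Proof. exact: polyfun_lower_bound (polyfun_bipoly a) q_neq0. Qed.

Let approx_qV : approx (fun z w => (q z w)^-1).
Proof. by have [d d0 dq] := bipoly_lower_bound; exact: approxV (polyfun_bipoly a) d0 dq. Qed.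

Let cbounded_qV : cbounded (fun z w => (q z w)^-1).
Proof.
have [d d0 dq] := bipoly_lower_bound; apply: (cboundedV d0) => [s t|].
  by apply: dq; rewrite normc_expi.
exact/polyfun_cbounded/polyfun_bipoly.
Qed.

Lemma bounded_measurable_qV2 : bounded_measurable (fun z w => (normc (q z w) ^+ 2)^-1).
Proof.
have [H _] := cboundedM cbounded_qV (cbounded_conj cbounded_qV).
by apply: bounded_measurable_eq H => z w; rewrite mulc_conj normcV exprVn.
Qed.

Lemma torus_mean_qV2_gt0 : 0 < S.
Proof.
have [M M0 qM] := polyfun_bounded (polyfun_bipoly a).
apply: (@lt_le_trans _ _ (M ^+ 2)^-1); first by rewrite invr_gt0 exprn_gt0.
rewrite -[leLHS]torus_mean_cst; apply: le_torus_mean => [||s t].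
- exact: bounded_measurable_cst.
- exact: bounded_measurable_qV2.
have s1 : normc (expi s) <= 1 by rewrite normc_expi.
have t1 : normc (expi t) <= 1 by rewrite normc_expi.
have q0 : 0 < normc (q (expi s) (expi t)) by rewrite normc_gt0 q_neq0.
by rewrite lef_pV2 ?posrE ?exprn_gt0// lerXn2r ?nnegrE ?normc_ge0 ?qM// ltW.
Qed.

Lemma cmean_sqr (f : C -> C -> C) :
  cmean (fun z w => f z w * (f z w)^*) =
  (torus_mean (fun z w => normc (f z w) ^+ 2))%:C.
Proof.
apply/eqP; rewrite eq_complex/=; apply/andP; split; apply/eqP.
  by apply: eq_torus_mean => s t; rewrite mulc_conj.
by rewrite -[RHS](@torus_mean_cst R); apply: eq_torus_mean => s t; rewrite mulc_conj.
Qed.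

(** This is the shape of the cross terms in the expansion of a squared modulus. *)
Lemma cmeanD_conj (c : C) (f : C -> C -> C) : cbounded f ->
  cbounded (fun z w => c * f z w + (c * f z w)^*) /\
  cmean (fun z w => c * f z w + (c * f z w)^*) = c * cmean f + (c * cmean f)^*.
Proof.
move=> bf; have bcf := cboundedM (cbounded_cst c) bf.
split; first exact: cboundedD (cbounded_conj bcf).
by rewrite cmeanD ?cmean_conj ?cmeanZ//; exact: cbounded_conj.
Qed.

(** Cauchy-Schwarz is carried out by hand. With [k] the weighted kernel built from [q] and its
    reflection, [G] below is [(1 - S k) / q], and [1 - S k] is [- S] times the component of [k]
    orthogonal to 1. The nonnegative mean of [|G|^2] comes out as [S (S (A - B) / D - 1)], where [A]
    and [B] are the squared moduli of [q] and its reflection at [(z0, w0)]. *)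
Lemma open_bidisk_bound (z0 w0 : C) : (0 < n)%N -> normc z0 < 1 -> normc w0 < 1 ->
  S^-1 * (1 - normc z0 ^+ 2) * (1 - normc w0 ^+ 2) <=
    normc (q z0 w0) ^+ 2 - normc (qr z0 w0) ^+ 2.
Proof.
move=> n0 z1 w1; have z1' := ltW z1; have w1' := ltW w1.
pose f z w := (q z w)^-1; pose K := szego z0 w0.
pose phi z w := qr z w * f z w.
have aK : approx K := approx_szego z1 w1.
have bK : cbounded K := cbounded_szego z1 w1.
have aqr : approx qr := approx_poly (polyfun_bipoly _).
have bqr : cbounded qr := polyfun_cbounded (polyfun_bipoly _).
have aphi : approx phi := approxM aqr approx_qV.
have bphi : cbounded phi := cboundedM bqr cbounded_qV.
(* On the torus [phi * conj f = z^n w^m f], so [V] equals the cross term [conj f * phi * K] there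
   while lying in the bidisk algebra. *)
pose V z w := z ^+ n * w ^+ m * f z w * K z w.
have pzw : polyfun (fun z w : C => z ^+ n * w ^+ m).
  by apply: polyfunM; apply: polyfunX; [exact: polyfun_fst|exact: polyfun_snd].
have aV : approx V by apply: approxM => //; apply: approxM => //; exact: approx_poly.
have bV : cbounded V by apply: cboundedM => //; apply: cboundedM => //; exact: polyfun_cbounded.
pose U z w := f z w * (K z w)^*.
have bU : cbounded U by apply: cboundedM => //; exact: cbounded_conj.
pose W1 z w := K z w * (K z w)^*.
have bW1 : cbounded W1 by apply: cboundedM => //; exact: cbounded_conj.
pose W2 z w := phi z w * K z w * (K z w)^*.
have bW2 : cbounded W2 by apply: cboundedM; [exact: cboundedM|exact: cbounded_conj].
have EU : cmean U = (q z0 w0)^-1 by rewrite /U cmean_szego.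
(* The mean is the value at the origin, where the factor [z^n] vanishes because [n > 0]. *)
have EV : cmean V = 0.
  by rewrite cmean_approx// /V expr0n -[n == 0%N]negbK -lt0n n0 !mul0r.
have EW1 : cmean W1 = K z0 w0 by rewrite /W1 (cmean_szego z1 w1).
have EW2 : cmean W2 = phi z0 w0 * K z0 w0.
  by rewrite /W2 (@cmean_szego _ z0 w0 z1 w1 (fun z w => phi z w * K z w))//;
    [exact: approxM|exact: cboundedM].
have q0 : q z0 w0 != 0 by exact: q_neq0.
set q0' := q z0 w0 in q0 EU *; set r0 := qr z0 w0.
pose l := S%:C.
pose G z w := f z w - l * ((q0'^* - phi z w * r0^*) * K z w).
have : 0 <= torus_mean (fun z w => normc (G z w) ^+ 2).
  by rewrite mulr_ge0 ?invr_ge0 ?exprn_ge0 ?(ltW (twopi_gt0 R))// Rintegral_ge0// => x _;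
    rewrite sqr_ge0.
rewrite -ler0c -cmean_sqr.
(* Coefficients of [|G|^2] on the torus: [c1 U], [c2 V] and [c4 W2] appear with their conjugates,
   and [|phi| = 1] merges the two diagonal terms into [c3 W1]. *)
pose c1 := - l * q0'; pose c2 := l * r0^*.
pose c3 := l ^+ 2 * (q0' * q0'^* + r0 * r0^*); pose c4 := - l ^+ 2 * (q0' * r0^*).
have [bU' EU'] := cmeanD_conj c1 bU.
have [bV' EV'] := cmeanD_conj c2 bV.
have [bW' EW'] := cmeanD_conj c4 bW2.
have bff : cbounded (fun z w => f z w * (f z w)^*).
  by apply: cboundedM => //; exact: cbounded_conj.
have bW1' : cbounded (fun z w => c3 * W1 z w) by apply: cboundedM => //; exact: cbounded_cst.
have -> : cmean (fun z w => G z w * (G z w)^*) =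
  cmean (fun z w => (f z w * (f z w)^* + (c1 * U z w + (c1 * U z w)^*)) +
    ((c2 * V z w + (c2 * V z w)^*) + (c3 * W1 z w + (c4 * W2 z w + (c4 * W2 z w)^*)))).
  apply: eq_cmean => s t.
  set z := expi s; set w := expi t.
  have nz : normc z = 1 := normc_expi s.
  have nw : normc w = 1 := normc_expi t.
  have qzw : q z w != 0 by apply: q_neq0; rewrite ?nz ?nw.
  have phiE : phi z w * (phi z w)^* = 1.
    rewrite mulc_conj /phi /f reflection_torus// !normcM !normcX nz nw normcV normc_conj.
    by rewrite !expr1n !mul1r divff ?normc_eq0// expr1n.
  have fphi : (f z w)^* * phi z w = z ^+ n * w ^+ m * f z w.
    rewrite /phi /f reflection_torus// fmorphV /=.
    by field; rewrite qzw conjC_eq0 qzw.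
  have VE : V z w = (f z w)^* * phi z w * K z w by rewrite fphi.
  have W1E : c3 * W1 z w = l ^+ 2 * (q0' * q0'^*) * W1 z w +
     l ^+ 2 * (r0 * r0^*) * (phi z w * (phi z w)^*) * W1 z w.
    by rewrite phiE /c3; ring.
  rewrite W1E VE /G /c1 /c2 /c4 /U /W1 /W2.
  rewrite !(rmorphD, rmorphB, rmorphM, rmorphN, rmorphXn, conjCK)/= /l !conj_real !conjCK.
  ring.
rewrite (cmeanD (cboundedD bff bU') (cboundedD bV' (cboundedD bW1' bW'))).
rewrite (cmeanD bff bU') (cmeanD bV' (cboundedD bW1' bW')) (cmeanD bW1' bW').
rewrite EU' EV' EW' cmeanZ// EU EV EW1 EW2.
have -> : cmean (fun z w => f z w * (f z w)^*) = l.
  rewrite cmean_sqr /l; congr (_%:C); apply: eq_torus_mean => s t.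
  by rewrite normcV exprVn.
pose D := (1 - normc z0 ^+ 2) * (1 - normc w0 ^+ 2).
have D0 : 0 < D by rewrite mulr_gt0// subr_gt0 exprn_ilt1 ?normc_ge0.
have KE : K z0 w0 = (D^-1)%:C.
  rewrite /K /szego !mulc_conj /D fmorphV; congr (_^-1).
  by rewrite [RHS]rmorphM /= !rmorphB /= rmorph1.
have c1E : c1 / q0' = - l by rewrite /c1; field.
have c4E : c4 * (phi z0 w0 * K z0 w0) = - (S ^+ 2 * normc r0 ^+ 2 / D)%:C.
  have -> : c4 * (phi z0 w0 * K z0 w0) = - (l ^+ 2 * (r0 * r0^*) * K z0 w0).
    by rewrite /c4 /phi -/r0 /f -/q0'; field.
  by rewrite mulc_conj KE /l -rmorphXn -!rmorphM.
have c3E : c3 * K z0 w0 = (S ^+ 2 * (normc q0' ^+ 2 + normc r0 ^+ 2) / D)%:C.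
  by rewrite /c3 !mulc_conj KE /l -rmorphXn -rmorphD -!rmorphM.
rewrite c1E c4E c3E mulr0 conjC0 !rmorphN /= /l !conj_real.
rewrite lecE => /andP[_]; rewrite !RecD /= => H.
have S0 := torus_mean_qV2_gt0.
rewrite -mulrA -/D; move: H S0 D0 {KE c4E c3E}.
move: (S) D (normc q0' ^+ 2) (normc r0 ^+ 2) => s D A B H s0 D0; move: H.
(* The mean is [s - 2 s + s^2 (A + B) / D - 2 s^2 B / D]. *)
rewrite (_ : _ + _ = s * (s * (A - B) / D - 1)); last by field; rewrite lt0r_neq0.
by rewrite pmulr_rge0// subr_ge0 ler_pdivlMr// mul1r ler_pdivrMl.
Qed.

End Forward.

(** * Radial limits and the converse implication *)

Section Boundary.
Variable R : realType.
Local Notation C := R[i].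

Lemma ge0_left_limit (h : R -> R) : {for 1, continuous h} ->
  (forall r, 0 < r -> r < 1 -> 0 <= h r) -> 0 <= h 1.
Proof.
move=> ch h0; have hl : h r @[r --> 1^'-] --> h 1 := cvg_at_left_filter ch.
apply: (@cvgr_to_ge _ _ _ _ _ _ _ hl).
near=> r; apply: h0.
  by near: r; apply: nbhs_left_gt; exact: ltr01.
by near: r; exact: nbhs_left_lt.
Unshelve. all: by end_near. Qed.

(** Real polynomials in [r] make factorization at [r = 1] and continuity available. *)
Lemma polyfun_ray (f : C -> C -> C) (z w : C) : polyfun f ->
  exists A B : {poly R},
    forall r : R, f (r%:C * z) (r%:C * w) = A.[r] +i* B.[r].
Proof.
have lin (x : C) : exists A B : {poly R}, forall r : R, r%:C * x = A.[r] +i* B.[r].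
  exists ('X * (Re x)%:P), ('X * (Im x)%:P) => r; rewrite !hornerE.
  by apply/eqP; rewrite eq_complex RecM ImcM /= !mul0r subr0 addr0 !eqxx.
elim=> [c|||{}f g _ [A [B fE]] _ [A' [B' gE]]|{}f g _ [A [B fE]] _ [A' [B' gE]]].
- by exists (Re c)%:P, (Im c)%:P => r; rewrite !hornerE; case: (c).
- exact: lin.
- exact: lin.
- exists (A + A'), (B + B') => r; rewrite fE gE !hornerE.
  by apply/eqP; rewrite eq_complex RecD ImcD !eqxx.
- exists (A * A' - B * B'), (A * B' + B * A') => r; rewrite fE gE !hornerE.
  by apply/eqP; rewrite eq_complex RecM ImcM !eqxx.
Qed.

(** A zero at [r = 1] is a common root of the real and imaginary parts, and each yields a factor
    [X - 1]. The identity covers every real [r], which later permits a parameter beyond 1. *)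
Lemma polyfun_ray_root (f : C -> C -> C) (z w : C) : polyfun f -> f z w = 0 ->
  exists N : {poly R}, (forall r, 0 <= N.[r]) /\
    forall r : R, normc (f (r%:C * z) (r%:C * w)) ^+ 2 = (1 - r) ^+ 2 * N.[r].
Proof.
move=> pf f0; have [A [B fE]] := polyfun_ray z w pf.
have := fE 1; rewrite rmorph1 !mul1r f0 => /eqP.
rewrite eq_complex /= => /andP[/eqP/esym/rootP A1 /eqP/esym/rootP B1].
have [A' AE] := factor_theorem _ _ A1; have [B' BE] := factor_theorem _ _ B1.
exists (A' ^+ 2 + B' ^+ 2); split=> r.
  by rewrite !hornerE addr_ge0// sqr_ge0.
by rewrite fE sqr_normcE /= AE BE !hornerE; ring.
Qed.

Variables (n m : nat) (a : 'M[C]_(n.+1, m.+1)).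
Local Notation q := (bipoly_eval a).
Local Notation qr := (bipoly_eval (reflection a)).

(** Along a ray the difference of both sides is a polynomial in [r], nonnegative for [0 < r < 1] and
    hence at 1. *)
Lemma bidisk_bound_closure (c : R) :
  (forall z w, normc z < 1 -> normc w < 1 ->
    c * (1 - normc z ^+ 2) * (1 - normc w ^+ 2) <= normc (q z w) ^+ 2 - normc (qr z w) ^+ 2) ->
  bidisk_bound a c.
Proof.
move=> H z w z1 w1.
have [A [B qE]] := polyfun_ray z w (polyfun_bipoly a).
have [A' [B' qrE]] := polyfun_ray z w (polyfun_bipoly (reflection a)).
pose P : {poly R} := A ^+ 2 + B ^+ 2 - (A' ^+ 2 + B' ^+ 2) -
  c%:P * (1 - ('X * (normc z)%:P) ^+ 2) * (1 - ('X * (normc w)%:P) ^+ 2).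
have PE (r : R) : 0 <= r -> P.[r] =
    normc (q (r%:C * z) (r%:C * w)) ^+ 2 - normc (qr (r%:C * z) (r%:C * w)) ^+ 2 -
    c * (1 - normc (r%:C * z) ^+ 2) * (1 - normc (r%:C * w) ^+ 2).
  move=> r0; rewrite !normcM !normc_real ger0_norm// qE qrE.
  by rewrite !(sqr_normcE (_ +i* _)) /= /P !hornerE; ring.
have : 0 <= P.[1].
  apply: ge0_left_limit => [|r r0 r1]; first exact: continuous_horner.
  have lt1 (x : C) : normc x <= 1 -> normc (r%:C * x) < 1.
    move=> x1; rewrite normcM normc_real gtr0_norm//.
    by rewrite (le_lt_trans _ r1)// ger_pMr.
  by rewrite PE ?(ltW r0)// subr_ge0 H// lt1.
by rewrite PE// rmorph1 !mul1r subr_ge0.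
Qed.

(** A zero would give [k (1 - r) <= (1 - r)^2 N(r)]; dividing by [1 - r] and letting [r] tend to 1
    contradicts [k > 0]. *)
Lemma no_zero_linear_bound (f : C -> C -> C) (z w : C) (k : R) : polyfun f -> 0 < k ->
  (forall r : R, 0 < r -> r < 1 ->
     k * (1 - r) <= normc (f (r%:C * z) (r%:C * w)) ^+ 2) -> f z w != 0.
Proof.
move=> pf k0 H; apply/eqP => /(polyfun_ray_root pf)[N [_ NE]].
have : 0 <= ((1 - 'X) * N - k%:P).[1].
  apply: ge0_left_limit => [|r r0 r1]; first exact: continuous_horner.
  rewrite !hornerE subr_ge0.
  by have := H r r0 r1; rewrite NE expr2 -mulrA [k * _]mulrC ler_pM2l// subr_gt0.
by rewrite !hornerE subrr mul0r add0r oppr_ge0 leNgt k0.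
Qed.

Lemma bidisk_bound_zero_free (c : R) : 0 < c -> bidisk_bound a c ->
  zero_free_closed_bidisk a.
Proof.
move=> c0 H z w z1 w1.
have lt1_sqr (x : C) : normc x < 1 -> 0 < 1 - normc x ^+ 2.
  by move=> x1; rewrite subr_gt0 exprn_ilt1 ?normc_ge0.
have ray_sqr (r : R) (x : C) : 0 < r -> normc x = 1 -> 1 - normc (r%:C * x) ^+ 2 = 1 - r ^+ 2.
  by move=> r0 x1; rewrite normcM normc_real gtr0_norm// x1 mulr1.
have ray_le1 (r : R) (x : C) : 0 < r -> r < 1 -> normc x <= 1 -> normc (r%:C * x) <= 1.
  by move=> r0 r1 x1; rewrite normc_scale_le1// !ltW.
have rr (r : R) : 0 < r -> r < 1 -> 1 - r <= 1 - r ^+ 2.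
  by move=> r0 r1; rewrite lerD2l lerN2 expr2 ger_pMr// ltW.
(* This weaker bound settles every case except that of two unimodular coordinates. *)
have Hq x y : normc x <= 1 -> normc y <= 1 ->
    c * (1 - normc x ^+ 2) * (1 - normc y ^+ 2) <= normc (q x y) ^+ 2.
  move=> x1 y1; apply: le_trans (H x y x1 y1) _.
  by rewrite gerBl sqr_ge0.
move: (z1) (w1); rewrite le_eqVlt => /predU1P[ez|lz]; rewrite le_eqVlt => /predU1P[ew|lw].
- apply/eqP => q0; have [N [N0 NE]] := polyfun_ray_root (polyfun_bipoly a) q0.
  (* The reflection at [(r z, r w)] has squared modulus [r^(2 (n + m)) |q(z / r, w / r)|^2], and
     [(1 - 1 / r)^2 = (1 - r)^2 r^-2]. So [h r] is the gap in the inequality divided by [(1 - r)^2],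
     while [h 1 = - 4 c]. *)
  pose h (r : R) := N.[r] - r ^+ (n + m).*2 * (r^-1 ^+ 2 * N.[r^-1]) - c * (1 + r) ^+ 2.
  have : 0 <= h 1.
    apply: ge0_left_limit => [|r r0 r1].
      have cV : {for 1, continuous (fun r : R => r^-1)}.
        by apply: inv_continuous; exact: oner_neq0.
      have cX k (g : R -> R) : {for 1, continuous g} -> {for 1, continuous (fun r => g r ^+ k)}.
        move=> cg; apply: (@continuous_comp _ _ _ g (fun x => x ^+ k)) => //.
        exact: exprn_continuous.
      have cid : {for 1, continuous (fun r : R => r)} by exact: cvg_id.
      apply: cvgB; last first.
        apply: cvgM; first exact: cvg_cst.
        by apply: cX; apply: cvgD; [exact: cvg_cst|exact: cid].
      apply: cvgB; first exact: continuous_horner.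
      apply: cvgM; first exact: cX.
      apply: cvgM; first exact: cX.
      apply: (@continuous_comp _ _ _ (fun r : R => r^-1) (horner N)) => //.
      exact: continuous_horner.
    have rn0 : r != 0 by rewrite gt_eqF.
    have d0 : 0 < (1 - r) ^+ 2 by rewrite exprn_gt0// subr_gt0.
    have := H (r%:C * z) (r%:C * w) (ray_le1 _ _ r0 r1 z1) (ray_le1 _ _ r0 r1 w1).
    have rC0 : r%:C != 0 :> C by rewrite (inj_eq (@complexI R)).
    have z0 : z != 0 by rewrite -normc_gt0 ez.
    have w0 : w != 0 by rewrite -normc_gt0 ew.
    have invz (x : C) : normc x = 1 -> ((r%:C * x)^*)^-1 = (r^-1)%:C * x.
      move=> x1; have x0 : x != 0 by rewrite -normc_gt0 x1.
      rewrite rmorphM /= conj_real invfM -fmorphV; congr (_ * _).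
      apply: (mulIf (_ : x^* != 0)); first by rewrite conjC_eq0.
      by rewrite mulVf ?conjC_eq0// mulc_conj x1 expr1n.
    rewrite !ray_sqr// reflectionE ?mulf_neq0// !invz// !normcM normc_conj.
    rewrite !normcX !normcM !normc_real ez ew !mulr1 gtr0_norm// -exprD.
    rewrite exprMn NE NE -exprM muln2 => Hr.
    rewrite -(pmulr_rge0 _ d0) /h.
    have -> : (1 - r) ^+ 2 *
        (N.[r] - r ^+ (n + m).*2 * (r^-1 ^+ 2 * N.[r^-1]) - c * (1 + r) ^+ 2) =
      (1 - r) ^+ 2 * N.[r] - r ^+ (n + m).*2 * ((1 - r^-1) ^+ 2 * N.[r^-1]) -
        c * (1 - r ^+ 2) * (1 - r ^+ 2).
      by field.
    by rewrite subr_ge0.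
  rewrite /h !(expr1n, invr1, mul1r) subrr sub0r oppr_ge0 leNgt.
  by rewrite mulr_gt0// exprn_gt0// addr_gt0.
(* Only [z] moves, and [1 - r <= 1 - r^2] makes the bound linear in [1 - r]. *)
- apply: (@no_zero_linear_bound (fun x _ => q x w) z w (c * (1 - normc w ^+ 2))).
  + by apply: polyfun_comp (polyfun_bipoly a) _ _; [exact: polyfun_fst|exact: polyfun_cst].
  + by rewrite mulr_gt0// lt1_sqr.
  + move=> r r0 r1; apply: le_trans (Hq _ _ (ray_le1 _ _ r0 r1 z1) w1).
    rewrite ray_sqr// mulrAC ler_pM2r ?lt1_sqr// ler_pM2l// rr//.
- apply: (@no_zero_linear_bound (fun _ y => q z y) z w (c * (1 - normc z ^+ 2))).
  + by apply: polyfun_comp (polyfun_bipoly a) _ _; [exact: polyfun_cst|exact: polyfun_snd].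
  + by rewrite mulr_gt0// lt1_sqr.
  + move=> r r0 r1; apply: le_trans (Hq _ _ z1 (ray_le1 _ _ r0 r1 w1)).
    by rewrite ray_sqr// ler_pM2l ?rr// mulr_gt0 ?lt1_sqr.
(* At an interior point the lower bound is itself positive. *)
- apply/eqP => qzw; have := Hq z w z1 w1.
  by rewrite qzw normc0 expr0n leNgt !mulr_gt0 ?lt1_sqr.
Qed.

End Boundary.

Theorem theorem1p1 (R : realType) (n m : nat) (hn : (0 < n)%N) (hm : (0 < m)%N)
    (a : 'M[R[i]]_(n.+1, m.+1)) :
  (zero_free_closed_bidisk a <-> exists c : R, 0 < c /\ bidisk_bound a c) /\
  (zero_free_closed_bidisk a ->
   exists c : R,
     [/\ 0 < c,
         (c^-1)%:E = torus_integral (fun z w => (normc (bipoly_eval a z w) ^+ 2)^-1)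
       & bidisk_bound a c]).
Proof.
have forward : zero_free_closed_bidisk a -> exists c : R, [/\ 0 < c,
    (c^-1)%:E = torus_integral (fun z w => (normc (bipoly_eval a z w) ^+ 2)^-1)
    & bidisk_bound a c].
  move=> q0; exists (torus_mean (fun z w => (normc (bipoly_eval a z w) ^+ 2)^-1))^-1.
  split.
  - by rewrite invr_gt0 torus_mean_qV2_gt0.
  - by rewrite invrK torus_integralE//; exact: bounded_measurable_qV2.
  (* Radial limits carry the estimate from the open bidisk to its closure. *)
  - by apply: bidisk_bound_closure => z w; exact: open_bidisk_bound.
split=> //; split=> [/forward[c [c0 _ bc]]|[c [c0 bc]]]; first by exists c.
exact: bidisk_bound_zero_free bc.
Qed.
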